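(* Let $K\subset\mathbb{R}^n$ be a convex body. Then $K$ is an ellipsoid if one of the following holds: (i) the set of lines $\ell\in G_{1,n}$ such that the midpoints of all chords of $K$ parallel to $\ell$ lie in a hyperplane is thick in $G_{1,n}$; (ii) the set of lines $\ell\in G_{1,n}$ such that there is a reflection of $K$ with direction $\ell$ is thick in $G_{1,n}$; (iii) the set of ground hyperplanes of non-orthogonal reflections of $K$ is thick in $G_{n-1,n}$.
   Context: A convex body is a compact convex set with nonempty interior. $G_{1,n}$ and $G_{n-1,n}$ are the Grassmannians of lines and of hyperplanes, respectively, through the origin in $\mathbb{R}^n$. A subset of a topological space is thick if it contains a nonempty open set. A chord of $K$ parallel to $\ell$ is the intersection of $K$ with a line parallel to $\ell$, when this is a segment. An ellipsoid in $\mathbb{R}^n$ is the image of a ball under an affine automorphism of $\mathbb{R}^n$. A reflection $\mathbf{r}:\mathbb{R}^n\to\mathbb{R}^n$ is a (not necessarily orthogonal, not necessarily linear) affine reflection: there are an affine hyperplane $M$, the mirror, which is fixed pointwise, and a line $\ell$ through the origin, the direction, which is not parallel to $M$, such that every line parallel to $\ell$ is rigidly inverted by $\mathbf{r}$ at its point of intersection with $M$. The reflection is orthogonal if its direction is orthogonal to its mirror. A reflection of $K$ is a reflection $\mathbf{r}$ with $\mathbf{r}(K)=K$. A hyperplane $\Gamma$ is a ground hyperplane of a reflection $\mathbf{r}$ if $\Gamma$ contains the direction of $\mathbf{r}$ (hence $\Gamma$ is invariant under $\mathbf{r}$) and the restriction of $\mathbf{r}$ to $\Gamma$ is an orthogonal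 reflection in $\Gamma$ (i.e. the direction $\ell$ is orthogonal to $M\cap\Gamma$); this notion depends on $\Gamma$ only up to parallelism, so ground hyperplanes are taken to pass through the origin, i.e. to be elements of $G_{n-1,n}$. *)

(* Defs.v *)
From HB Require Import structures.
From mathcomp Require Import all_boot all_order all_algebra.
From mathcomp Require Import all_classical all_reals all_analysis.

Set Implicit Arguments.
Unset Strict Implicit.
Unset Printing Implicit Defensive.

Import Order.TTheory GRing.Theory Num.Theory.
Import numFieldNormedType.Exports.

Local Open Scope classical_set_scope.
Local Open Scope ring_scope.

(* [all_analysis] puts the topology of R^n on 'rV[R]_n, but with the sup-norm:
   [`|x|] and [ball] there are not Euclidean, hence [dotp] and [eball]. *)

Definition dotp (R : realType) (n : nat) (u v : 'rV[R]_n) : R :=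
  \sum_(i < n) u 0 i * v 0 i.

Definition eball (R : realType) (n : nat) (c : 'rV[R]_n) (r : R) :
    set 'rV[R]_n :=
  [set x | dotp (x - c) (x - c) <= r ^+ 2].

Definition ellipsoid (R : realType) (n : nat) (E : set 'rV[R]_n) : Prop :=
  exists (c : 'rV[R]_n) (r : R) (A : 'M[R]_n) (b : 'rV[R]_n),
    [/\ 0 < r, A \in unitmx & E = (fun x => x *m A + b) @` eball c r].

Definition convex_body (R : realType) (n : nat) (K : set 'rV[R]_n) : Prop :=
  [/\ compact K, @convex_set R 'rV[R]_n K & interior K !=set0].

Definition thick (T : topologicalType) (A : set T) : Prop :=
  exists U : set T, [/\ open U, U !=set0 & U `<=` A].

Definition grassmannian (R : realType) (k n : nat) : Type :=
  {V : {vspace 'rV[R]_n} | \dim V == k}.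

HB.instance Definition _ (R : realType) (k n : nat) :=
  Choice.on (grassmannian R k n).

(* The non-compact Stiefel manifold, with the subspace topology of matrices. *)
Definition frame (R : realType) (k n : nat) : Type :=
  set_type [set A : 'M[R]_(k, n) | row_free A].

HB.instance Definition _ (R : realType) (k n : nat) :=
  Topological.on (frame R k n).

Definition row_span (R : realType) (k n : nat) (A : 'M[R]_(k, n)) :
    {vspace 'rV[R]_n} :=
  <<[tuple row i A | i < k]>>%VS.

Lemma dim_row_span (R : realType) (k n : nat) (A : 'M[R]_(k, n)) :
  row_free A -> \dim (row_span A) == k.
Proof.
move=> fA; suff /eqP -> : free [tuple row i A | i < k] by rewrite size_tuple.
apply/freeP => c c0 i.
suff /rowP/(_ i) : \row_j c j = 0 by rewrite !mxE.
apply: (row_free_inj fA); rewrite mul0mx mulmx_sum_row -[RHS]c0.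
by apply: eq_bigr => j _; rewrite mxE nth_mktuple.
Qed.

Definition frame_span (R : realType) (k n : nat) (F : frame R k n) :
    grassmannian R k n :=
  Sub (row_span (set_val F)) (dim_row_span (set_valP F)).

(* The topology of the Grassmannian is the quotient topology of [frame_span]. *)
Section grassmannian_topology.
Context (R : realType) (k n : nat).

Let gop : set_system (grassmannian R k n) :=
  [set U | open (@frame_span R k n @^-1` U)].

Let gopT : gop setT.
Proof. by rewrite /gop /= preimage_setT; exact: openT. Qed.

Let gopI : setI_closed gop.
Proof. by move=> U V oU oV; rewrite /gop /= preimage_setI; exact: openI. Qed.

Let gop_bigU (I : Type) (f : I -> set (grassmannian R k n)) :
  (forall i, gop (f i)) -> gop (\bigcup_i f i).
Proof.
by move=> of_; rewrite /gop /= preimage_bigcup; apply: bigcup_open => i _; exact: of_.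
Qed.

HB.instance Definition _ :=
  isOpenTopological.Build (grassmannian R k n) gopT gopI gop_bigU.

End grassmannian_topology.

Lemma open_grassmannianE (R : realType) (k n : nat)
    (U : set (grassmannian R k n)) :
  open U = open (@frame_span R k n @^-1` U).
Proof. by []. Qed.

Definition affine_subspace (R : realType) (n : nat) (p : 'rV[R]_n)
    (V : {vspace 'rV[R]_n}) : set 'rV[R]_n :=
  [set x | x - p \in V].

Definition segment (R : realType) (n : nat) (a b : 'rV[R]_n) :
    set 'rV[R]_n :=
  [set (1 - t) *: a + t *: b | t in [set t : R | 0 <= t <= 1]].

(* [a != b]: a line that meets K in a single point carries no chord. *)
Definition chord_midpoint (R : realType) (n : nat) (K : set 'rV[R]_n)
    (l : grassmannian R 1 n) : set 'rV[R]_n :=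
  [set m | exists p a b : 'rV[R]_n,
    [/\ a != b, K `&` affine_subspace p (val l) = segment a b
      & m = 2^-1 *: (a + b)]].

(* The mirror is [affine_subspace p (val H)]; the case v = 0 says that it is
   fixed pointwise, and affinity of [r] follows because l and H span R^n. *)
Definition is_reflection (R : realType) (n : nat) (r : 'rV[R]_n -> 'rV[R]_n)
    (l : grassmannian R 1 n) (p : 'rV[R]_n) (H : grassmannian R n.-1 n) :
    Prop :=
  ~~ (val l <= val H)%VS /\
  forall m v : 'rV[R]_n,
    affine_subspace p (val H) m -> v \in val l -> r (m + v) = m - v.

Definition orthogonal_to (R : realType) (n : nat) (l : grassmannian R 1 n)
    (A : set 'rV[R]_n) : Prop :=
  forall u x y : 'rV[R]_n, u \in val l -> A x -> A y -> dotp u (x - y) = 0.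

(* A reflection enters through its direction [l] and its mirror [M]. *)
Definition ground (R : realType) (n : nat) (G : grassmannian R n.-1 n)
    (l : grassmannian R 1 n) (M : set 'rV[R]_n) : Prop :=
  (val l <= val G)%VS /\ orthogonal_to l (M `&` [set x | x \in val G]).

(* Hyperplanes have index n.-1; this is 0 for n = 0, where there are no lines,
   so that the three sets below are then empty. *)
Definition flat_midpoint_lines (R : realType) (n : nat) (K : set 'rV[R]_n) :
    set (grassmannian R 1 n) :=
  [set l | exists (p : 'rV[R]_n) (H : grassmannian R n.-1 n),
    chord_midpoint K l `<=` affine_subspace p (val H)].

Definition reflection_lines (R : realType) (n : nat) (K : set 'rV[R]_n) :
    set (grassmannian R 1 n) :=
  [set l | exists r (p : 'rV[R]_n) (H : grassmannian R n.-1 n),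
    is_reflection r l p H /\ r @` K = K].

Definition nonorthogonal_ground_hyperplanes (R : realType) (n : nat)
    (K : set 'rV[R]_n) : set (grassmannian R n.-1 n) :=
  [set G | exists r (l : grassmannian R 1 n) (p : 'rV[R]_n)
      (H : grassmannian R n.-1 n),
    [/\ is_reflection r l p H, r @` K = K,
        ~ orthogonal_to l (affine_subspace p (val H))
      & ground G l (affine_subspace p (val H))]].

(* Main.v *)
Require Import Defs.
From mathcomp Require Import all_boot all_order all_algebra.
From mathcomp Require Import all_classical all_reals all_analysis.
From mathcomp Require Import ring lra.
Import numFieldNormedType.Exports.
Import Order.TTheory GRing.Theory Num.Theory.

Set Implicit Arguments.
Unset Strict Implicit.
Unset Printing Implicit Defensive.

Local Open Scope classical_set_scope.
Local Open Scope ring_scope.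

(** All affine symmetries of K fix a common point c of K and preserve a common
    positive definite quadratic form Q ([invariant_center], [invariant_form]);
    both come from [common_fixed_point].  Hence every reflection of K has its
    mirror through c and Q-conjugate to its direction u, so that it is the map
    [refl Q u] around c, and K is governed by the set D of these directions,
    called [axes].  Since a reflection conjugated by another one is again a
    reflection of K, D is stable under its own reflections
    ([axes_reflection_closed]).  If D contains every nonzero vector, K is
    invariant under all Q-reflections, hence a union of Q-spheres, hence a
    Q-ball, that is, an ellipsoid ([axes_full_ellipsoid]).

    It remains to see that D is everything.  In a plane, the axes at angles 0
    and t generate those at all multiples of t.  If D contains a whole arc of
    the plane, then it contains the whole plane, because an arbitrary angle is
    k times an angle in that arc ([short_arc_full_plane]).  So a set D with an
    interior point is everything ([open_axes_full]), which settles the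
    hypothesis on directions of reflections.  If the midpoints of the chords
    parallel to a line lie in a hyperplane, the reflection in that hyperplane
    along that line preserves K ([flat_midpoint_skew]), which reduces the
    hypothesis on midpoints to the previous one.

    The hypothesis on ground hyperplanes says less about D.  A normal g of a
    ground hyperplane is orthogonal to the direction u and lies in the span of
    u and u Q, so u Q = b u + a g with a nonzero ([ground_axes]).  If D is not
    everything, then D lies in finitely many hyperplanes ([axes_dichotomy]):
    either the axes are separated, hence finite in number up to scaling, or
    they have a limit direction.  In the latter case D contains a plane
    ([small_angles_plane]), and a subspace V of maximal dimension among those
    contained in D satisfies that D lies in the union of V and its Q-orthogonal
    complement, for an axis neither in V nor orthogonal to V would enlarge V
    ([axis_subspace_extend]).  But the directions u in finitely many hyperplanes
    cannot produce an open set of normals g.  This is proved algebraically in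
    [sparse_normals]: eliminating u and b with the help of the adjugate of b - Q
    shows that a suitable line contains only finitely many such normals. *)

(** * Dot product, norms and continuity *)

Section DotProduct.
Context (R : realType).

Lemma dotpE n (u v : 'rV[R]_n) : dotp u v = (u *m v^T) 0 0.
Proof. by rewrite mxE; apply: eq_bigr => i _; rewrite mxE. Qed.

Lemma dotpC n (u v : 'rV[R]_n) : dotp u v = dotp v u.
Proof. by apply: eq_bigr => i _; rewrite mulrC. Qed.

Lemma dotpDl n (u v w : 'rV[R]_n) : dotp (u + v) w = dotp u w + dotp v w.
Proof. by rewrite !dotpE mulmxDl mxE. Qed.

Lemma dotpDr n (u v w : 'rV[R]_n) : dotp w (u + v) = dotp w u + dotp w v.
Proof. by rewrite dotpC dotpDl !(dotpC w). Qed.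

Lemma dotpZl n a (u w : 'rV[R]_n) : dotp (a *: u) w = a * dotp u w.
Proof. by rewrite !dotpE -scalemxAl mxE. Qed.

Lemma dotpZr n a (u w : 'rV[R]_n) : dotp w (a *: u) = a * dotp w u.
Proof. by rewrite dotpC dotpZl dotpC. Qed.

Lemma dotpNl n (u w : 'rV[R]_n) : dotp (- u) w = - dotp u w.
Proof. by rewrite -scaleN1r dotpZl mulN1r. Qed.

Lemma dotpNr n (u w : 'rV[R]_n) : dotp w (- u) = - dotp w u.
Proof. by rewrite dotpC dotpNl dotpC. Qed.

Lemma dotpBl n (u v w : 'rV[R]_n) : dotp (u - v) w = dotp u w - dotp v w.
Proof. by rewrite dotpDl dotpNl. Qed.

Lemma dotpBr n (u v w : 'rV[R]_n) : dotp w (u - v) = dotp w u - dotp w v.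
Proof. by rewrite dotpDr dotpNr. Qed.

Lemma dotp0l n (w : 'rV[R]_n) : dotp 0 w = 0.
Proof. by rewrite -(scale0r 0) dotpZl mul0r. Qed.

Lemma dotp0r n (w : 'rV[R]_n) : dotp w 0 = 0.
Proof. by rewrite dotpC dotp0l. Qed.

Definition dotp_lin := (dotpDl, dotpDr, dotpZl, dotpZr, dotpNl, dotpNr,
  dotp0l, dotp0r).

Lemma dotp_mull m n (u : 'rV[R]_m) (A : 'M[R]_(m, n)) (v : 'rV[R]_n) :
  dotp (u *m A) v = dotp u (v *m A^T).
Proof. by rewrite !dotpE trmx_mul trmxK mulmxA. Qed.

Lemma dotp_ge0 n (u : 'rV[R]_n) : 0 <= dotp u u.
Proof. by apply: sumr_ge0 => i _; rewrite -expr2 sqr_ge0. Qed.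

Lemma dotp_eq0 n (u : 'rV[R]_n) : (dotp u u == 0) = (u == 0).
Proof.
apply/idP/eqP => [/eqP u0|->]; last by rewrite dotp0l.
apply/rowP => i; rewrite mxE; apply/eqP; rewrite -sqrf_eq0 expr2.
by apply/eqP; apply: (psumr_eq0P _ u0) => // j _; rewrite -expr2 sqr_ge0.
Qed.

Lemma dotp_gt0 n (u : 'rV[R]_n) : u != 0 -> 0 < dotp u u.
Proof. by move=> u0; rewrite lt_def dotp_eq0 u0 dotp_ge0. Qed.

Lemma dotp_delta n (u : 'rV[R]_n) i : dotp u (delta_mx 0 i) = u 0 i.
Proof.
rewrite /dotp (bigD1 i) //= big1 ?mxE ?eqxx ?mulr1 ?addr0 // => j ji.
by rewrite mxE (negbTE ji) andbF mulr0.
Qed.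

Lemma coord_le_norm m n (A : 'M[R]_(m, n)) i j : `|A i j| <= `|A|.
Proof.
rewrite [leRHS]/Num.norm /= mx_normrE.
by apply/bigmax_geP; right => /=; exists (i, j).
Qed.

Lemma norm_le_coord m n (A : 'M[R]_(m, n)) a : 0 <= a ->
  (forall i j, `|A i j| <= a) -> `|A| <= a.
Proof.
move=> a0 Aa; rewrite [leLHS]/Num.norm /= mx_normrE.
by apply/bigmax_leP; split=> // -[i j] _; exact: Aa.
Qed.

Lemma norm_sqr_le_dotp n (u : 'rV[R]_n) : `|u| ^+ 2 <= dotp u u.
Proof.
rewrite -[leRHS]sqr_sqrtr ?dotp_ge0 // lerXn2r ?nnegrE ?sqrtr_ge0 //.
apply: norm_le_coord; rewrite ?sqrtr_ge0 // => i j.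
rewrite ord1 -sqrtr_sqr ler_wsqrtr // /dotp (bigD1 j) //= -expr2 lerDl.
by apply: sumr_ge0 => k _; rewrite -expr2 sqr_ge0.
Qed.

Lemma dotp_le_norm n (u v : 'rV[R]_n) : `|dotp u v| <= n%:R * (`|u| * `|v|).
Proof.
apply: le_trans (ler_norm_sum _ _ _) _.
apply: (@le_trans _ _ (\sum_(i < n) `|u| * `|v|)).
  by apply: ler_sum => i _; rewrite normrM ler_pM // coord_le_norm.
by rewrite sumr_const card_ord mulr_natl.
Qed.

Lemma norm_mulmx_le m n p (A : 'M[R]_(m, n)) (B : 'M[R]_(n, p)) :
  `|A *m B| <= n%:R * (`|A| * `|B|).
Proof.
apply: norm_le_coord => [|i j]; first by rewrite !mulr_ge0.
rewrite mxE; apply: le_trans (ler_norm_sum _ _ _) _.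
apply: (@le_trans _ _ (\sum_(i < n) `|A| * `|B|)).
  by apply: ler_sum => k _; rewrite normrM ler_pM // coord_le_norm.
by rewrite sumr_const card_ord mulr_natl.
Qed.

Lemma sum_continuous (T : topologicalType) (I : Type) (r : seq I) (P : pred I)
    (f : I -> T -> R) x : (forall i, {for x, continuous (f i)}) ->
  {for x, continuous (fun t => \sum_(i <- r | P i) f i t)}.
Proof.
move=> cf; elim: r => [|i r ih].
  under [X in {for _, continuous X}]eq_fun do rewrite big_nil.
  exact: cst_continuous.
under [X in {for _, continuous X}]eq_fun do rewrite big_cons.
by case: (P i) => //; apply: continuousD.
Qed.

Lemma mx_continuous (T : topologicalType) m n (f : T -> 'M[R]_(m, n)) x :
  (forall i j, {for x, continuous (fun t => f t i j)}) ->
  {for x, continuous f}.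
Proof.
move=> cf A [P Pf sPA].
have : \forall t \near x, forall ij : 'I_m * 'I_n, P ij.1 ij.2 (f t ij.1 ij.2).
  by apply: filter_forall => -[i j] /=; apply: cf; exact: Pf.
by apply: filterS => t Pt; apply: sPA => i j; exact: (Pt (i, j)).
Qed.

Lemma coord_comp_continuous (T : topologicalType) m n (f : T -> 'M[R]_(m, n)) x
    i j : {for x, continuous f} -> {for x, continuous (fun t => f t i j)}.
Proof.
move=> cf; exact: (continuous_comp cf (@coord_continuous R _ _ i j (f x))).
Qed.

Lemma mulmx_continuous (T : topologicalType) m n p (f : T -> 'M[R]_(m, n))
    (g : T -> 'M[R]_(n, p)) x :
  {for x, continuous f} -> {for x, continuous g} ->
  {for x, continuous (fun t => f t *m g t)}.
Proof.
move=> cf cg; apply: mx_continuous => i j.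
under [X in {for _, continuous X}]eq_fun do rewrite mxE.
by apply: sum_continuous => k; apply: continuousM; exact: coord_comp_continuous.
Qed.

Lemma dotp_continuous (T : topologicalType) n (f g : T -> 'rV[R]_n) x :
  {for x, continuous f} -> {for x, continuous g} ->
  {for x, continuous (fun t => dotp (f t) (g t))}.
Proof.
move=> cf cg.
by apply: sum_continuous => k; apply: continuousM; exact: coord_comp_continuous.
Qed.

Lemma cst_continuous_at (T U : topologicalType) (b : U) (x : T) :
  {for x, continuous (fun=> b)}.
Proof. exact: cst_continuous. Qed.

Lemma line_continuous n (x u : 'rV[R]_n) : continuous (fun t : R => x + t *: u).
Proof.
move=> t; apply: mx_continuous => i j.
have -> : (fun t : R => (x + t *: u) i j) = (fun t => x i j + t * u i j).
  by apply/funext => s; rewrite !mxE.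
exact: (continuousD (@cst_continuous_at _ _ _ _)
  (continuousM (@cvg_id _ _) (@cst_continuous_at _ _ _ _))).
Qed.

Lemma open_along_line n (W : set 'rV[R]_n) x u : open W -> W x ->
  exists2 eps : R, 0 < eps & forall t, `|t| < eps -> W (x + t *: u).
Proof.
move=> oW Wx.
have : \forall t \near (0 : R), W (x + t *: u).
  apply: (@line_continuous _ x u 0 W); apply: open_nbhs_nbhs.
  by split=> //; rewrite scale0r addr0.
move=> /nbhs_ballP[eps /= eps0 epsW]; exists eps => // t teps.
by apply: epsW; rewrite /ball /= sub0r normrN.
Qed.

Lemma affine_continuous m n (M : 'M[R]_(m, n)) (b : 'rV[R]_n) :
  continuous (fun x : 'rV[R]_m => x *m M + b).
Proof.
move=> x; have h1 : {for x, continuous (fun x : 'rV[R]_m => x *m M)}.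
  by apply: (@mulmx_continuous _ _ _ _ id (fun=> M)); [apply: cvg_id|apply: cst_continuous_at].
have h2 : {for x, continuous (fun _ : 'rV[R]_m => b)} by apply: cst_continuous_at.
exact: (continuousD h1 h2).
Qed.

Lemma subr_continuous n (c : 'rV[R]_n) : continuous (fun x : 'rV[R]_n => x - c).
Proof.
move=> x; have := @affine_continuous n n 1%:M (- c) x.
by under eq_fun do rewrite mulmx1.
Qed.

Lemma row_space_normal m n (V : 'M[R]_(m, n)) : (\rank V < n)%N ->
  exists2 w : 'rV[R]_n, w != 0 & V *m w^T = 0.
Proof.
move=> rV; have : kermx V^T != 0.
  by rewrite -mxrank_eq0 mxrank_ker mxrank_tr -lt0n subn_gt0.
move/rowV0Pn => [w /sub_kermxP wV w0]; exists w => //.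
by apply: trmx_inj; rewrite trmx_mul trmxK trmx0.
Qed.

Lemma vector_normal n (u : 'rV[R]_n) : (1 < n)%N ->
  exists2 w : 'rV[R]_n, w != 0 & dotp w u = 0.
Proof.
move=> n1; have [w w0 uw] := @row_space_normal 1 n u (leq_ltn_trans (rank_leq_row u) n1).
by exists w; rewrite // dotpC dotpE uw mxE.
Qed.

End DotProduct.

(** * A fixed point theorem for semigroups of midpoint-preserving maps *)

Section FixedPoint.
Context (R : realType).

(** The convex function x |-> sup of |g x|^2 over g in G does not increase along
    G, and the lower bound on |g x - g y| with the parallelogram law makes it
    strictly convex.  Its minimiser over C, which exists by compactness, is
    therefore unique, and so fixed by G. *)
Lemma common_fixed_point N (C : set 'rV[R]_N) (G : set ('rV[R]_N -> 'rV[R]_N)) :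
  compact C -> C !=set0 ->
  (forall x y, C x -> C y -> C (2^-1 *: (x + y))) ->
  (forall g h, G g -> G h -> G (g \o h)) ->
  (forall g x, G g -> C x -> C (g x)) ->
  (forall g x y, G g -> g (2^-1 *: (x + y)) = 2^-1 *: (g x + g y)) ->
  (forall g, G g -> continuous g) ->
  (forall x y, x != y ->
    exists2 d : R, 0 < d & forall g, G g -> d <= dotp (g x - g y) (g x - g y)) ->
  exists2 p, C p & forall g, G g -> g p = p.
Proof.
move=> Cc [x0 Cx0] Cmid Gcomp GC Gmid Gcont Gsep.
have [[g0 Gg0]|G0] := pselect (exists g, G g); last first.
  by exists x0 => // g Gg; case: G0; exists g.
(* The infimum of L is the minimal value of x |-> sup over g of |g x|^2; working
   with upper bounds a makes it unnecessary to form that supremum. *)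
pose L : set R := [set a | exists2 x, C x & forall g, G g -> dotp (g x) (g x) <= a].
have [b _ bP] : exists2 b, b \in C & forall t, t \in C -> dotp t t <= dotp b b.
  apply: compact_EVT_max => //; first by exists x0.
  by apply: continuous_subspaceT => x; apply: dotp_continuous; exact: cvg_id.
have L0 : has_inf L.
  split.
    exists (dotp b b), x0 => // g Gg; apply: bP; rewrite inE; exact: GC.
  by exists 0 => a [x Cx /(_ _ Gg0)]; apply: le_trans; exact: dotp_ge0.
have [p Cp pL] : exists2 p, C p & forall g, G g -> dotp (g p) (g p) <= inf L.
  apply: contrapT => nop.
  have hp p : C p -> exists2 g, G g & inf L < dotp (g p) (g p).
    move=> Cp; apply: contrapT => noG; apply: nop; exists p => // g Gg.
    by rewrite leNgt; apply/negP => lt; apply: noG; exists g.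
  (* Were the minimum not attained, compactness of C would leave a uniform gap e
     above inf L. *)
  have cov : \forall e \near 0^'+,
      C `<=` (fun x => exists2 g, G g & inf L + e < dotp (g x) (g x)).
    move/compact_near_coveringP : Cc; apply => x Cx.
    have [g Gg gx] := hp x Cx.
    have cg : {for x, continuous (fun t => dotp (g t) (g t))}.
      by apply: dotp_continuous; exact: Gcont.
    pose c := (inf L + dotp (g x) (g x)) / 2.
    have c1 : c < dotp (g x) (g x) by rewrite /c; lra.
    have c2 : 0 < c - inf L by rewrite /c; lra.
    near=> x' e => /=; exists g => //.
    apply: (@lt_trans _ _ c); last by near: x'; exact: (cvgr_gt _ cg).
    rewrite -ltrBrDl; near: e; exact: nbhs_right_lt.
  near (0 : R)^'+ => e.
  have e0 : 0 < e by [].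
  have [a [x Cx xa] aL] := inf_adherent e0 L0.
  have [g Gg] : exists2 g, G g & inf L + e < dotp (g x) (g x).
    exact: (near cov e).
  by rewrite ltNge (le_trans (xa _ Gg)) // ltW.
exists p => // h Gh; apply/eqP/negPn/negP => hp.
(* If h moves p, the midpoint of p and h p does better than the infimum. *)
have [d d0 dP] := Gsep _ _ hp.
have : L (inf L - d / 4).
  exists (2^-1 *: (h p + p)); first by apply: Cmid => //; exact: GC.
  move=> g Gg; rewrite Gmid //.
  have := dP _ Gg; have := pL _ Gg; have := pL _ (Gcomp _ _ Gg Gh) => /=.
  rewrite !dotp_lin (dotpC (g p) (g (h p))); lra.
move=> /(ge_inf L0.2); rewrite lerBrDr gerDl leNgt divr_gt0 //.
Unshelve. all: by end_near. Qed.

End FixedPoint.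

(** * Convex bodies and their affine symmetries *)

Section ConvexBody.
Context (R : realType) (n : nat).
Implicit Types (K : set 'rV[R]_n) (M Q : 'M[R]_n) (x y u v b : 'rV[R]_n).

Definition bform Q x y : R := dotp (x *m Q) y.

(** The equivalence encodes that x |-> x M + b maps K onto itself, since M is
    invertible. *)
Definition affine_symmetry K M b : Prop :=
  M \in unitmx /\ forall x, K (x *m M + b) <-> K x.

Lemma convex_bodyP K x y (t : R) : convex_body K -> 0 <= t <= 1 ->
  K x -> K y -> K ((1 - t) *: x + t *: y).
Proof.
move=> [_ cK _] /andP[t0 t1] Kx Ky.
have := cK y x (Itv01 t0 t1); rewrite !inE => /(_ Ky Kx).
by rewrite addrC.
Qed.

Lemma convex_body_interior K : convex_body K ->
  exists x0 r, [/\ K x0, 0 < r & forall v, `|v| <= r -> K (x0 + v)].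
Proof.
move=> [_ _ [x0]]; rewrite /interior/= => /nbhs_ballP[r /= r0 rK].
exists x0, (r / 2); split; first exact/rK/ballxx.
  by rewrite divr_gt0.
move=> v vr; apply: rK; rewrite -ball_normE /= opprD addNKr normrN.
by rewrite (le_lt_trans vr) // ltr_pdivrMr // ltr_pMr // ltr1n.
Qed.

Lemma convex_body_bounded K : convex_body K ->
  exists2 B, 0 < B & forall x, K x -> `|x| <= B.
Proof.
move=> [cK _ _]; have /ex_strict_bound_gt0[B B0 BK] := compact_bounded cK.
by exists B => // x Kx; apply/ltW/BK.
Qed.

Lemma affine_symmetry_comp K M b M' b' : affine_symmetry K M b ->
  affine_symmetry K M' b' -> affine_symmetry K (M *m M') (b *m M' + b').
Proof.
move=> [uM sM] [uM' sM']; split; first by rewrite unitmx_mul uM.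
move=> x; rewrite addrA mulmxA -mulmxDl; split.
  by move=> /sM' /sM.
by move=> /sM /sM'.
Qed.

Lemma affine_symmetry_inv K M b : affine_symmetry K M b ->
  affine_symmetry K (invmx M) (- (b *m invmx M)).
Proof.
move=> [uM sM]; split; first by rewrite unitmx_inv.
move=> x; have := sM (x *m invmx M - b *m invmx M).
rewrite mulmxBl !mulmxKV // subrK; tauto.
Qed.

(** K - K contains a ball, is bounded, and is preserved by linear parts of
    symmetries.  Applied to inverses as well, this gives the separation
    hypothesis of [common_fixed_point]. *)
Lemma affine_symmetry_bound K : convex_body K ->
  exists2 c, 0 < c & forall M b, affine_symmetry K M b ->
    forall v, `|v *m M| <= c * `|v|.
Proof.
move=> bK; have [x0 [r [Kx0 r0 rK]]] := convex_body_interior bK.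
have [B B0 BK] := convex_body_bounded bK.
exists (2 * B / r); first by rewrite divr_gt0 // mulr_gt0.
move=> M b [uM sM] v; have [->|v0] := eqVneq v 0.
  by rewrite mul0mx !normr0 mulr0.
have nv : 0 < `|v| by rewrite normr_gt0.
pose w := (r / `|v|) *: v.
have nw : `|w| <= r by rewrite normrZ gtr0_norm ?divr_gt0 // divfK // gt_eqF.
have : `|w *m M| <= 2 * B.
  have -> : w *m M = ((x0 + w) *m M + b) - (x0 *m M + b).
    by rewrite mulmxDl opprD addrACA subrr addr0 addrAC subrr add0r.
  apply: le_trans (ler_normB _ _) _; rewrite mulr_natl mulr2n lerD //.
    by apply/BK/sM/rK.
  exact/BK/sM.
rewrite -scalemxAl normrZ gtr0_norm ?divr_gt0 // -ler_pdivlMl ?divr_gt0 //.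
by move/le_trans; apply; rewrite invfM invrK le_eqVlt; apply/orP; left; apply/eqP; ring.
Qed.

Lemma invariant_center K : convex_body K ->
  exists2 c, K c & forall M b, affine_symmetry K M b -> c *m M + b = c.
Proof.
move=> bK; have [c c0 cP] := affine_symmetry_bound bK.
pose G : set ('rV[R]_n -> 'rV[R]_n) :=
  [set g | exists M b, affine_symmetry K M b /\ g = fun x => x *m M + b].
have [cK _ _] := bK; have [x0 [_ [Kx0 _ _]]] := convex_body_interior bK.
have [|||||||p Kp pP] := @common_fixed_point R n K G cK; first by exists x0.
- move=> x y Kx Ky; have -> : 2^-1 *: (x + y) = (1 - 2^-1) *: x + 2^-1 *: y.
    by rewrite scalerDr; congr (_ *: _ + _); lra.
  by apply: convex_bodyP => //; lra.
- move=> g h [M [b [sM ->]]] [M' [b' [sM' ->]]].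
  exists (M' *m M), (b' *m M + b); split; first exact: affine_symmetry_comp.
  by apply/funext => x /=; rewrite mulmxDl -!addrA mulmxA.
- by move=> g x [M [b [[_ sM] ->]]] /sM.
- move=> g x y [M [b [_ ->]]]; rewrite -scalemxAl mulmxDl addrACA.
  rewrite [in RHS]scalerDr; congr (_ + _).
  by rewrite -mulr2n -[b *+ 2]scaler_nat scalerA mulVf ?scale1r ?pnatr_eq0.
- by move=> g [M [b [_ ->]]]; exact: affine_continuous.
- move=> x y; rewrite -subr_eq0 => xy; exists ((`|x - y| / c) ^+ 2).
    by rewrite exprn_gt0 // divr_gt0 // normr_gt0.
  move=> g [M [b [sM ->]]]; rewrite opprD addrACA subrr addr0 -mulmxBl.
  apply: le_trans (norm_sqr_le_dotp _).
  have c0' := ltW c0.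
  apply: lerXn2r; rewrite ?nnegrE ?divr_ge0 // ler_pdivrMr // mulrC.
  have := cP _ _ (affine_symmetry_inv sM) ((x - y) *m M).
  by rewrite mulmxK //; case: sM.
exists p => // M b sM; apply: (pP (fun x => x *m M + b)).
by exists M, b.
Qed.

End ConvexBody.

(** * The invariant quadratic form *)

Section InvariantForm.
Context (R : realType) (n : nat).
Implicit Types (K : set 'rV[R]_n) (M Q : 'M[R]_n) (x y u v b : 'rV[R]_n).

Lemma bformDl Q x y z : bform Q (x + y) z = bform Q x z + bform Q y z.
Proof. by rewrite /bform mulmxDl dotpDl. Qed.

Lemma bformDr Q x y z : bform Q z (x + y) = bform Q z x + bform Q z y.
Proof. by rewrite /bform dotpDr. Qed.

Lemma bformZl Q a x z : bform Q (a *: x) z = a * bform Q x z.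
Proof. by rewrite /bform -scalemxAl dotpZl. Qed.

Lemma bformZr Q a x z : bform Q z (a *: x) = a * bform Q z x.
Proof. by rewrite /bform dotpZr. Qed.

Lemma bformNl Q x z : bform Q (- x) z = - bform Q x z.
Proof. by rewrite -scaleN1r bformZl mulN1r. Qed.

Lemma bformNr Q x z : bform Q z (- x) = - bform Q z x.
Proof. by rewrite -scaleN1r bformZr mulN1r. Qed.

Lemma bform0l Q z : bform Q 0 z = 0.
Proof. by rewrite /bform mul0mx dotp0l. Qed.

Lemma bform0r Q z : bform Q z 0 = 0.
Proof. by rewrite /bform dotp0r. Qed.

Definition bform_lin := (bformDl, bformDr, bformZl, bformZr, bformNl, bformNr, bform0l,
  bform0r).

Lemma bformC Q x y : Q^T = Q -> bform Q x y = bform Q y x.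
Proof. by move=> sQ; rewrite /bform dotp_mull sQ dotpC. Qed.

Lemma bform_mul M Q x y : bform (M *m Q *m M^T) x y = bform Q (x *m M) (y *m M).
Proof. by rewrite /bform !mulmxA [LHS]dotp_mull trmxK. Qed.

Lemma bform_delta Q i j : bform Q (delta_mx 0 i) (delta_mx 0 j) = Q i j.
Proof. by rewrite /bform dotp_delta -rowE mxE. Qed.

Lemma bform_continuous (T : topologicalType) (F : T -> 'M[R]_n)
    (f g : T -> 'rV[R]_n) t :
  {for t, continuous F} -> {for t, continuous f} -> {for t, continuous g} ->
  {for t, continuous (fun s => bform (F s) (f s) (g s))}.
Proof.
by move=> cF cf cg; exact: (dotp_continuous (mulmx_continuous cf cF) cg).
Qed.

Definition posdef Q : Prop := Q^T = Q /\ forall x, x != 0 -> 0 < bform Q x x.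

Let difference_body K : set 'rV[R]_n :=
  [set u | exists x y, [/\ K x, K y & u = x - y]].

Let difference_body_symmetry K M b u : affine_symmetry K M b ->
  difference_body K (u *m M) <-> difference_body K u.
Proof.
suff H M' b' u' : affine_symmetry K M' b' -> difference_body K u' ->
    difference_body K (u' *m M').
  move=> sM; split; last exact: H sM.
  by move/(H _ _ _ (affine_symmetry_inv sM)); rewrite mulmxK //; case: sM.
move=> [_ sM] [x [y [Kx Ky ->]]]; exists (x *m M' + b'), (y *m M' + b').
by split; [exact/sM|exact/sM|rewrite opprD addrACA subrr addr0 mulmxBl].
Qed.

(** The fixed point theorem needs a compact convex set of forms on which the
    linear parts of symmetries act.  Bounding the form from below off the
    difference body K - K and from above on it is an invariant condition; the
    lower bound makes the form positive definite, and the upper bound makes the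
    set bounded.  Forms are flattened to row vectors, where bounded closed sets
    are known to be compact. *)
Let pinched K lam : set 'rV[R]_(n * n) := [set q |
  [/\ (vec_mx q)^T = vec_mx q,
      forall x, ~ difference_body K x -> 1 <= bform (vec_mx q) x x &
      forall x, difference_body K x -> bform (vec_mx q) x x <= lam]].

Let vec_mx_form_continuous x y :
  continuous (fun q : 'rV[R]_(n * n) => bform (vec_mx q) x y).
Proof.
move=> q; apply: bform_continuous; try exact: cst_continuous.
apply: mx_continuous => i j.
under [X in {for _, continuous X}]eq_fun do rewrite mxE.
exact: coord_continuous.
Qed.

Let pinched_closed K lam : closed (pinched K lam).
Proof.
have -> : pinched K lam =
   (\bigcap_(ij in [set: 'I_n * 'I_n]) [set q |
      bform (vec_mx q) (delta_mx 0 ij.2) (delta_mx 0 ij.1) -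
      bform (vec_mx q) (delta_mx 0 ij.1) (delta_mx 0 ij.2) = 0]) `&`
   ((\bigcap_(x in [set x | ~ difference_body K x])
      [set q | 1 <= bform (vec_mx q) x x]) `&`
   (\bigcap_(x in [set x | difference_body K x])
      [set q | bform (vec_mx q) x x <= lam])).
  apply/seteqP; split => q.
    by move=> [sq q1 q2]; split => //= ij _; rewrite /= !bform_delta -{1}sq mxE subrr.
  move=> [sq [q1 q2]]; split=> //; apply/matrixP => i j; apply/eqP.
  by rewrite -subr_eq0 mxE; have := sq (i, j) I; rewrite /= !bform_delta => ->.
apply: closedI; last apply: closedI.
- apply: closed_bigI => -[i j] _ /=.
  apply: (@closed_comp _ _ (fun q =>
    bform (vec_mx q) (delta_mx 0 j) (delta_mx 0 i) -
    bform (vec_mx q) (delta_mx 0 i) (delta_mx 0 j)) [set 0]); last exact: closed_eq.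
  move=> q _.
  exact: (continuousB (@vec_mx_form_continuous _ _ q) (@vec_mx_form_continuous _ _ q)).
- apply: closed_bigI => x _.
  apply: (@closed_comp _ _ (fun q => bform (vec_mx q) x x) [set t | 1 <= t]);
    last exact: closed_ge.
  by move=> q _; exact: vec_mx_form_continuous.
- apply: closed_bigI => x _.
  apply: (@closed_comp _ _ (fun q => bform (vec_mx q) x x) [set t | t <= lam]);
    last exact: closed_le.
  by move=> q _; exact: vec_mx_form_continuous.
Qed.

Let difference_body_bounded K : convex_body K ->
  exists2 B, 0 < B & forall u, difference_body K u -> `|u| <= B.
Proof.
move=> bK; have [B B0 BK] := convex_body_bounded bK.
exists (2 * B); first by rewrite mulr_gt0.
move=> _ [x [y [Kx Ky ->]]]; apply: le_trans (ler_normB _ _) _.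
by rewrite mulr_natl mulr2n lerD // BK.
Qed.

Let difference_body_nbhs K : convex_body K ->
  exists2 r, 0 < r & forall u, `|u| <= r -> difference_body K u.
Proof.
move=> bK; have [x0 [r [Kx0 r0 rK]]] := convex_body_interior bK.
exists r => // u ur; exists (x0 + u), x0; split=> //; first exact: rK.
by rewrite addrC addKr.
Qed.

Let pinched_posdef K lam q : convex_body K -> pinched K lam q ->
  posdef (vec_mx q).
Proof.
move=> bK [sq q1 _]; have [B B0 BK] := difference_body_bounded bK.
split=> // x x0; have nx : 0 < `|x| by rewrite normr_gt0.
have /q1 : ~ difference_body K (((B + 1) / `|x|) *: x).
  have B1 : 0 <= (B + 1) / `|x| by rewrite divr_ge0 // addr_ge0 // ltW.
  move/BK; rewrite normrZ ger0_norm //.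
  by rewrite divfK ?gt_eqF // leNgt ltrDl ltr01.
rewrite bformZl bformZr mulrA => /(lt_le_trans ltr01).
by rewrite pmulr_rgt0 // mulr_gt0 // divr_gt0 // addr_gt0.
Qed.

(* The diagonal entries are bounded by the upper bound on a ball inside K - K,
   and the others follow by polarisation. *)
Let pinched_bounded K lam : convex_body K -> bounded_set (pinched K lam).
Proof.
move=> bK; have [r r0 rK] := difference_body_nbhs bK.
have small Q i j : pinched K lam (mxvec Q) -> `|Q i j| <= 6 * lam / r ^+ 2.
  move=> pQ; have [sQ pos] := pinched_posdef bK pQ; case: pQ => _ _.
  rewrite mxvecK in sQ pos *; move=> q2.
  have pos0 x : 0 <= bform Q x x.
    have [->|/pos/ltW//] := eqVneq x 0; by rewrite bform0l.
  have le1 x : `|x| <= 2 -> bform Q x x <= 4 * lam / r ^+ 2.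
    move=> x2; have /q2 : difference_body K ((r / 2) *: x).
      apply: rK; rewrite normrZ gtr0_norm ?divr_gt0 //.
      by rewrite mulrAC ler_pdivrMr // ler_pM2l.
    rewrite bformZl bformZr => h.
    rewrite ler_pdivlMr ?exprn_gt0 //.
    rewrite -[leLHS](_ : 4 * (r / 2 * (r / 2 * bform Q x x)) = _); last by field.
    by rewrite ler_pM2l.
  have nd k : `|delta_mx 0 k : 'rV[R]_n| <= 1.
    by apply: norm_le_coord => // a c; rewrite mxE; case: (_ && _); rewrite ?normr1 ?normr0.
  have n1 : `|delta_mx 0 i + delta_mx 0 j : 'rV[R]_n| <= 2.
    by apply: le_trans (ler_normD _ _) _; have := nd i; have := nd j; lra.
  have di : bform Q (delta_mx 0 i) (delta_mx 0 i) <= 4 * lam / r ^+ 2.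
    by apply: le1; have := nd i; lra.
  have dj : bform Q (delta_mx 0 j) (delta_mx 0 j) <= 4 * lam / r ^+ 2.
    by apply: le1; have := nd j; lra.
  have := le1 _ n1; have := pos0 (delta_mx 0 i + delta_mx 0 j).
  have := pos0 (delta_mx 0 j); have := pos0 (delta_mx 0 i).
  rewrite !bform_lin (bformC (delta_mx 0 j) (delta_mx 0 i) sQ).
  rewrite [bform Q (delta_mx 0 i) (delta_mx 0 j)]bform_delta.
  rewrite -![_ * lam / _]mulrA in di dj *.
  by move=> *; rewrite ler_norml; apply/andP; split; lra.
exists `|6 * lam / r ^+ 2|; split; first exact: num_real.
move=> t lt q pq; apply: le_trans (ltW lt); apply: norm_le_coord => // i k.
rewrite ord1; case/mxvec_indexP: k => a c; apply: le_trans (ler_norm _).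
by have := @small (vec_mx q) a c; rewrite vec_mxK mxE; exact.
Qed.

Let pinched_nonempty K : convex_body K -> exists lam, pinched K lam !=set0.
Proof.
move=> bK; have [r r0 rK] := difference_body_nbhs bK.
have [B B0 BK] := difference_body_bounded bK.
have formE x : bform (r ^- 2)%:M x x = r ^- 2 * dotp x x.
  by rewrite /bform mul_mx_scalar dotpZl.
have r2 : 0 < r ^- 2 by rewrite invr_gt0 exprn_gt0.
exists (r ^- 2 * (n%:R * (B * B))), (mxvec (r ^- 2)%:M) => /=.
rewrite /pinched /= mxvecK; split; first exact: tr_scalar_mx.
- move=> x nx; rewrite formE ler_pdivlMl ?exprn_gt0 // mulr1.
  have /ltW rx : r < `|x| by rewrite ltNge; apply/negP => /rK.
  apply: le_trans (norm_sqr_le_dotp x).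
  by apply: lerXn2r; rewrite ?nnegrE // ltW.
- move=> x /BK xB; rewrite formE ler_pM2l //.
  apply: le_trans (ler_norm _) _; apply: le_trans (dotp_le_norm _ _) _.
  by rewrite ler_wpM2l // ler_pM.
Qed.

Lemma invariant_form K : convex_body K ->
  exists2 Q, posdef Q &
    forall M b, affine_symmetry K M b -> M *m Q *m M^T = Q.
Proof.
move=> bK; have [lam [q0 pq0]] := pinched_nonempty bK.
have [c c0 cP] := affine_symmetry_bound bK.
pose act M q : 'rV[R]_(n * n) := mxvec (M *m vec_mx q *m M^T).
have actB M q q' : act M q - act M q' = act M (q - q').
  by rewrite /act [vec_mx (_ - _)]linearB mulmxBr mulmxBl [mxvec (_ - _)]linearB.
pose G : set ('rV[R]_(n * n) -> 'rV[R]_(n * n)) :=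
  [set g | exists M b, affine_symmetry K M b /\ g = act M].
have := @common_fixed_point R (n * n) (pinched K lam) G.
case.
- by apply: bounded_closed_compact; [exact: pinched_bounded|exact: pinched_closed].
- by exists q0.
- move=> q q' [sq q1 q2] [sq' q1' q2']; split.
  + by rewrite linearZ linearD /= linearZ linearD /= sq sq'.
  + move=> x nx; have := q1 x nx; have := q1' x nx.
    rewrite linearZ linearD /= /bform -scalemxAr mulmxDr dotpZl dotpDl; lra.
  + move=> x nx; have := q2 x nx; have := q2' x nx.
    rewrite linearZ linearD /= /bform -scalemxAr mulmxDr dotpZl dotpDl; lra.
- move=> g h [M [b [sM ->]]] [M' [b' [sM' ->]]].
  exists (M *m M'), (b *m M' + b'); split; first exact: affine_symmetry_comp.
  by apply/funext => q; rewrite /act /= mxvecK trmx_mul !mulmxA.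
- move=> g q [M [b [sM ->]]] [sq q1 q2]; split.
  + by rewrite mxvecK !trmx_mul trmxK sq mulmxA.
  + move=> x nx; rewrite mxvecK bform_mul; apply: q1 => /(difference_body_symmetry _ sM).
    exact: nx.
  + move=> x nx; rewrite mxvecK bform_mul; apply: q2.
    exact/(difference_body_symmetry _ sM).
- move=> g q q' [M [b [_ ->]]].
  by rewrite /act linearZ linearD /= -scalemxAr mulmxDr -scalemxAl mulmxDl linearZ linearD.
- move=> g [M [b [_ ->]]] q; apply: mx_continuous => i k; rewrite ord1.
  case/mxvec_indexP: k => a d.
  rewrite (_ : (fun t => act M t 0 (mxvec_index a d)) =
      (fun t => bform (vec_mx t) (delta_mx 0 a *m M) (delta_mx 0 d *m M))).
    exact: vec_mx_form_continuous.
  by apply/funext => t; rewrite mxvecE -bform_mul bform_delta.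
- move=> q q'; rewrite -subr_eq0 => qq'.
  pose C := (n%:R * c) ^+ 2 + 1.
  have C0 : 0 < C by rewrite /C ltr_wpDl // sqr_ge0.
  exists ((`|q - q'| / C) ^+ 2).
    by rewrite exprn_gt0 // divr_gt0 // normr_gt0.
  move=> g [M [b [sM ->]]]; rewrite actB; set p := q - q'.
  apply: le_trans (norm_sqr_le_dotp _).
  have C0' := ltW C0.
  apply: lerXn2r; rewrite ?nnegrE ?divr_ge0 // ler_pdivrMr // mulrC.
  have uM : M \in unitmx by case: sM.
  have nM : `|invmx M| <= c.
    apply: norm_le_coord; first exact: ltW.
    move=> i j; have -> : invmx M i j = ((delta_mx 0 i : 'rV[R]_n) *m invmx M) 0 j.
      by rewrite -rowE mxE.
    apply: le_trans (coord_le_norm _ _ _) _.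
    apply: le_trans (cP _ _ (affine_symmetry_inv sM) _) _.
    rewrite ger_pMr //; apply: norm_le_coord => // k l; rewrite mxE.
    by case: (_ && _); rewrite ?normr1 ?normr0.
  have vec_norm (A : 'M[R]_n) : `|A| <= `|mxvec A|.
    apply: norm_le_coord => // i j; rewrite -[A i j]mxvecE.
    exact: coord_le_norm.
  have norm_vec (v : 'rV[R]_(n * n)) : `|v| <= `|vec_mx v : 'M[R]_n|.
    apply: norm_le_coord => // i k; rewrite ord1; case/mxvec_indexP: k => a d.
    by have := coord_le_norm (vec_mx v : 'M[R]_n) a d; rewrite mxE.
  apply: le_trans (norm_vec p) _.
  have -> : vec_mx p = invmx M *m (M *m vec_mx p *m M^T) *m (invmx M)^T.
    by rewrite trmx_inv !mulmxA mulVmx // mul1mx mulmxK // unitmx_tr.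
  have := vec_norm (M *m vec_mx p *m M^T); rewrite -/(act M p).
  set P := M *m _ *m _ => nP.
  apply: le_trans (norm_mulmx_le _ _) _.
  have nT : `|(invmx M)^T| <= c.
    apply: norm_le_coord; first exact: ltW.
    by move=> i j; rewrite mxE; apply: le_trans nM; exact: coord_le_norm.
  apply: (@le_trans _ _ (n%:R * ((n%:R * (c * `|act M p|)) * c))).
    rewrite ler_wpM2l // ler_pM //.
    apply: le_trans (norm_mulmx_le _ _) _.
    by rewrite ler_wpM2l // ler_pM.
  rewrite (_ : n%:R * _ = (n%:R * c) ^+ 2 * `|act M p|); last by ring.
  by rewrite ler_wpM2r // /C lerDl.
move=> q pq qP; exists (vec_mx q); first exact: pinched_posdef pq.
move=> M b sM; apply: (can_inj mxvecK); rewrite vec_mxK.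
by apply: (qP (act M)); exists M, b.
Qed.

End InvariantForm.

(** * Ellipsoids as sublevel sets of positive definite forms *)

Section Cholesky.
Context (R : realType).

(** Cholesky factorisation, by induction through the Schur complement S of the
    first entry. *)
Lemma posdef_factor n (Q : 'M[R]_n) : posdef Q ->
  exists2 P, P \in unitmx & Q = P *m P^T.
Proof.
elim: n Q => [|n IH] Q [sQ pos].
  by exists 1%:M; [exact: unitmx1|apply/matrixP => -[]].
pose a := Q 0 0; pose b : 'rV[R]_n := ursubmx (Q : 'M[R]_(1 + n)).
pose C : 'M[R]_n := drsubmx (Q : 'M[R]_(1 + n)).
have QE : Q = (block_mx a%:M b b^T C : 'M[R]_(1 + n)).
  have e1 : ulsubmx (Q : 'M[R]_(1 + n)) = a%:M.
    by rewrite [LHS]mx11_scalar; congr (_%:M); rewrite !mxE; congr (Q _ _); apply/val_inj.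
  have e2 : dlsubmx (Q : 'M[R]_(1 + n)) = b^T by rewrite /b trmx_ursub sQ.
  by rewrite -[LHS](@submxK R 1 n 1 n) e1 e2.
have a0 : 0 < a.
  have := pos (delta_mx 0 0); rewrite bform_delta; apply.
  by apply/eqP => /rowP /(_ 0); rewrite !mxE !eqxx => /eqP; rewrite oner_eq0.
pose S := C - a^-1 *: (b^T *m b).
have sC : C^T = C by rewrite trmx_drsub sQ.
have [P' uP' SE] : exists2 P, P \in unitmx & S = P *m P^T.
  apply: IH; split.
    by rewrite linearB linearZ /= trmx_mul trmxK sC.
  move=> x x0; pose y : 'rV[R]_(1 + n) := row_mx (- a^-1 *: (x *m b^T)) x.
  have : y != 0.
    by apply: contra x0 => /eqP; rewrite -row_mx0 => /eq_row_mx[_ ->].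
  move/pos; suff -> : bform Q y y = bform S x x by [].
  rewrite /bform QE /y !dotpE (@mul_row_block R 1 1 n 1 n) (@tr_row_mx R 1 1 n).
  rewrite (@mul_row_col R 1 1 n 1).
  rewrite -scalemxAl mul_mx_scalar scalerA mulNr mulVf ?gt_eqF //.
  rewrite scaleN1r [X in X *m _]addNr mul0mx add0r; congr ((_ *m _) _ _).
  by rewrite mulmxBr -scalemxAr addrC scaleNr mulNmx -scalemxAl mulmxA.
exists (block_mx (Num.sqrt a)%:M 0 ((Num.sqrt a)^-1 *: b^T) P' : 'M[R]_(1 + n)).
  rewrite unitmxE (@det_lblock R 1 n) unitrM det_scalar1 -unitmxE uP' andbT.
  by rewrite unitfE sqrtr_eq0 -ltNge.
have sa : Num.sqrt a * Num.sqrt a = a by rewrite -expr2 sqr_sqrtr // ltW.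
have sa0 : Num.sqrt a != 0 by rewrite sqrtr_eq0 -ltNge.
rewrite QE (@tr_block_mx R 1 n 1 n) (@mulmx_block R 1 n 1 n 1 n) !trmx0 !mulmx0 !mul0mx !addr0.
rewrite linearZ /= trmxK tr_scalar_mx mul_scalar_mx scale_scalar_mx sa.
rewrite mul_scalar_mx scalerA divff // scale1r mul_mx_scalar scalerA divff // scale1r.
rewrite -SE -scalemxAl -scalemxAr scalerA -invfM sa.
by rewrite addrC subrK.
Qed.

Lemma ellipsoid_form n (Q : 'M[R]_n) c m : posdef Q -> 0 < m ->
  ellipsoid [set x | bform Q (x - c) (x - c) <= m].
Proof.
move=> /posdef_factor[P uP ->] m0.
exists 0, (Num.sqrt m), (invmx P), c; split; rewrite ?unitmx_inv ?sqrtr_gt0 //.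
have formE x : bform (P *m P^T) x x = dotp (x *m P) (x *m P).
  by rewrite /bform mulmxA dotp_mull trmxK.
apply/seteqP; split => x /=; rewrite formE.
  move=> h; exists ((x - c) *m P); last by rewrite mulmxK // subrK.
  by rewrite /eball /= subr0 sqr_sqrtr // ltW.
move=> [y yr <-]; move: yr; rewrite /eball /= subr0 addrK mulmxKV //.
by rewrite sqr_sqrtr // ltW.
Qed.

End Cholesky.

(** * Reflections orthogonal for a positive definite form *)

Section Reflections.
Context (R : realType) (n : nat).
Implicit Types (K D : set 'rV[R]_n) (Q : 'M[R]_n) (c x y z u v w : 'rV[R]_n).

Definition refl Q u x := x - (2 * bform Q x u / bform Q u u) *: u.

Lemma posdef_neq0 Q u : posdef Q -> u != 0 -> bform Q u u != 0.
Proof. by move=> [_ pos] /pos; exact: lt0r_neq0. Qed.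

Lemma bform_refl Q u x y : posdef Q -> u != 0 ->
  bform Q (refl Q u x) (refl Q u y) = bform Q x y.
Proof.
move=> pQ u0; have [sQ _] := pQ; have := posdef_neq0 pQ u0.
rewrite /refl !bform_lin (bformC u y sQ) => uu.
by field.
Qed.

Lemma reflZl Q a u x : a != 0 -> refl Q (a *: u) x = refl Q u x.
Proof.
move=> a0; rewrite /refl !bform_lin scalerA; congr (_ - _ *: _).
have [->|uu] := eqVneq (bform Q u u) 0; first by rewrite !(mulr0, invr0, mul0r).
by field; rewrite a0 uu.
Qed.

Lemma reflD Q u x y : refl Q u (x + y) = refl Q u x + refl Q u y.
Proof.
by rewrite /refl bformDl mulrDr mulrDl scalerDl opprD addrACA.
Qed.

Lemma reflZr Q a u x : refl Q u (a *: x) = a *: refl Q u x.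
Proof. by rewrite /refl !bform_lin scalerBr scalerA; congr (_ - _ *: _); ring. Qed.

Lemma reflB Q u x y : refl Q u (x - y) = refl Q u x - refl Q u y.
Proof. by rewrite reflD -(scaleN1r y) reflZr scaleN1r. Qed.

Lemma reflK Q u x : posdef Q -> u != 0 -> refl Q u (refl Q u x) = x.
Proof.
move=> pQ u0; have := posdef_neq0 pQ u0 => uu.
rewrite /refl !bform_lin -addrA -opprD -scalerDl.
by rewrite [X in X *: _](_ : _ = 0) ?scale0r ?subr0 //; field.
Qed.

Lemma refl_neq0 Q u x : posdef Q -> u != 0 -> x != 0 -> refl Q u x != 0.
Proof.
move=> pQ u0; apply: contra => /eqP ux.
by rewrite -(reflK x pQ u0) ux /refl !bform_lin mulr0 mul0r scale0r subr0.
Qed.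

Lemma refl_conj Q u v x : posdef Q -> u != 0 ->
  refl Q (refl Q u v) x = refl Q u (refl Q v (refl Q u x)).
Proof.
move=> pQ u0.
rewrite {1}/refl bform_refl // -{1 2}(reflK x pQ u0) bform_refl //.
by rewrite -reflZr -reflB.
Qed.

Lemma refl_sub Q x y : posdef Q -> x != y -> bform Q x x = bform Q y y ->
  refl Q (x - y) x = y.
Proof.
move=> pQ; rewrite -subr_eq0 => xy exy; have := posdef_neq0 pQ xy => h.
have [sQ _] := pQ.
rewrite /refl (_ : _ / _ = 1) ?scale1r ?subKr //.
move: h; rewrite !bform_lin (bformC y x sQ) exy => h.
by field.
Qed.

(** Abstract properties of the set of axes of a group generated by reflections;
    the roots of a root system, up to scaling, have them. *)
Definition reflection_closed Q D : Prop :=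
  [/\ forall u, D u -> u != 0,
      forall a u, a != 0 -> D u -> D (a *: u) &
      forall u v, D u -> D v -> D (refl Q u v)].

(** An inclusion suffices, because [refl Q u] is an involution. *)
Definition axes K Q c : set 'rV[R]_n :=
  [set u | u != 0 /\ forall x, K (c + x) -> K (c + refl Q u x)].

Lemma axes_reflection_closed K Q c : posdef Q -> reflection_closed Q (axes K Q c).
Proof.
move=> pQ; split=> [u []//|a u a0 [u0 uK]|u v [u0 uK] [v0 vK]].
  split=> [|x]; first by rewrite scaler_eq0 negb_or a0.
  by rewrite reflZl //; exact: uK.
split=> [|x Kx]; first exact: refl_neq0.
by rewrite refl_conj //; apply/uK/vK/uK.
Qed.

(** Let m be the largest value of Q(x - c) on K.  Any two vectors of equal
    Q-norm are exchanged by the reflection along their difference, so K contains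
    the whole sphere of level m around c, and by convexity the ball. *)
Lemma axes_full_ellipsoid K Q c : convex_body K -> posdef Q -> K c ->
  (exists u, u != 0 :> 'rV[R]_n) -> (forall u, u != 0 -> axes K Q c u) ->
  ellipsoid K.
Proof.
move=> bK pQ Kc [u0 u00] full.
have [cK _ _] := bK.
have [z] : exists2 z, z \in K & forall t, t \in K ->
    bform Q (t - c) (t - c) <= bform Q (z - c) (z - c).
  apply: (@compact_EVT_max _ R (fun t : 'rV[R]_n => bform Q (t - c) (t - c))) => //.
    by exists c.
  apply: continuous_subspaceT => x.
  have cc := @subr_continuous R n c x.
  exact: (bform_continuous (@cst_continuous_at _ _ Q x) cc cc).
rewrite inE => Kz; set m := bform Q (z - c) (z - c) => mP.
have m0 : 0 < m.
  have [x0 [r [Kx0 r0 rK]]] := convex_body_interior bK.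
  have [x Kx xc] : exists2 x, K x & x != c.
    have [xc|] := eqVneq x0 c; last by exists x0.
    exists (x0 + (r / `|u0|) *: u0).
      by apply: rK; rewrite normrZ gtr0_norm ?divr_gt0 ?normr_gt0 // divfK ?normr_eq0.
    rewrite xc -subr_eq0 addrAC subrr add0r scaler_eq0 negb_or u00 andbT.
    by rewrite mulf_neq0 ?invr_eq0 ?normr_eq0 // gt_eqF.
  apply: lt_le_trans (mP x _); last by rewrite inE.
  by case: pQ => _; apply; rewrite subr_eq0.
have sphere w : bform Q w w = m -> K (c + w).
  move=> wm; have [<-|zw] := eqVneq (z - c) w; first by rewrite addrC subrK.
  rewrite -[w](refl_sub pQ zw) //.
  have [|_] := full (z - c - w); first by rewrite subr_eq0.
  by apply; rewrite addrC subrK.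
suff -> : K = [set x | bform Q (x - c) (x - c) <= m] by exact: ellipsoid_form.
apply/seteqP; split=> x /=; first by move=> Kx; apply: mP; rewrite inE.
have -> : K x = K (c + (x - c)) by rewrite addrC subrK.
move: (x - c) => y ym.
have [->|y0] := eqVneq y 0; first by rewrite addr0.
have [_ /(_ _ y0) qy] := pQ.
pose t := Num.sqrt (m / bform Q y y).
have tt : t * t = m / bform Q y y by rewrite -expr2 sqr_sqrtr // divr_ge0 // ltW.
have t1 : 1 <= t by rewrite -sqrtr1 ler_wsqrtr // ler_pdivlMr // mul1r.
have t0 : 0 < t by apply: lt_le_trans t1.
have s1 : K (c + t *: y).
  by apply: sphere; rewrite !bform_lin mulrA tt divfK // gt_eqF.
have s2 : K (c + (- t) *: y).
  by apply: sphere; rewrite !bform_lin mulrA mulrNN tt divfK // gt_eqF.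
(* y is a convex combination of the two points of the sphere on its line *)
have ti : t^-1 <= 1 by rewrite invf_le1.
have ti0 : 0 < t^-1 by rewrite invr_gt0.
have -> : c + y = (1 - (1 + t^-1) / 2) *: (c + (- t) *: y) +
                  ((1 + t^-1) / 2) *: (c + t *: y).
  rewrite !scalerDr addrACA -scalerDl !scalerA -scalerDl subrK scale1r.
  by congr (_ + _); rewrite -[LHS]scale1r; congr (_ *: _); field; rewrite gt_eqF.
by apply: convex_bodyP => //; lra.
Qed.

End Reflections.

(** * Axes in a plane *)

Section Arcs.
Context (R : realType) (n : nat).
Implicit Types (K D O : set 'rV[R]_n) (Q : 'M[R]_n) (c x y z u v w e f : 'rV[R]_n).

Definition orthonormal2 Q e f : Prop :=
  [/\ bform Q e e = 1, bform Q f f = 1 & bform Q e f = 0].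

Definition circle_pt e f (t : R) : 'rV[R]_n := cos t *: e + sin t *: f.

Lemma posdef_normalize Q u : posdef Q -> u != 0 ->
  exists e r, [/\ 0 < r, bform Q e e = 1 & u = r *: e].
Proof.
move=> [_ pos] /[dup] u0 /pos uu; pose r := Num.sqrt (bform Q u u).
have r0 : 0 < r by rewrite sqrtr_gt0.
have rr : r * r = bform Q u u by rewrite -expr2 sqr_sqrtr // ltW.
exists (r^-1 *: u), r; split=> //; last by rewrite scalerA divff ?scale1r // gt_eqF.
by rewrite !bform_lin -rr; field; rewrite gt_eqF.
Qed.

(** Gram-Schmidt for two vectors. *)
Lemma orthonormal2_exists Q u v : posdef Q -> u != 0 ->
  (forall a, v != a *: u) ->
  exists e f r a b, [/\ orthonormal2 Q e f, 0 < r, 0 < b, u = r *: e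
    & v = a *: e + b *: f].
Proof.
move=> pQ u0 vu; have [e [r [r0 ee ur]]] := posdef_normalize pQ u0.
have [sQ _] := pQ.
have : v - bform Q v e *: e != 0.
  rewrite subr_eq0; have := vu (bform Q v e / r).
  by rewrite ur scalerA divfK // gt_eqF.
move/(posdef_normalize pQ) => [f [b [b0 ff fb]]].
exists e, f, r, (bform Q v e), b; split=> //; last by rewrite -fb addrC subrK.
split=> //; apply/eqP; rewrite -(mulrI_eq0 _ (mulfI (lt0r_neq0 b0))).
by rewrite -bformZr -fb !bform_lin ee (bformC e v sQ) mulr1 subrr.
Qed.

Lemma bform_circle_pt Q e f s t : posdef Q -> orthonormal2 Q e f ->
  bform Q (circle_pt e f s) (circle_pt e f t) = cos (s - t).
Proof.
move=> [sQ _] [ee ff ef]; rewrite /circle_pt !bform_lin ee ff ef (bformC f e sQ) ef.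
by rewrite cosB; ring.
Qed.

Lemma refl_circle_pt Q e f s t : posdef Q -> orthonormal2 Q e f ->
  refl Q (circle_pt e f s) (circle_pt e f t) = - circle_pt e f (2 * s - t).
Proof.
move=> pQ oef; rewrite /refl !(bform_circle_pt _ _ pQ oef) subrr cos0 divr1 -[t - s]opprB cosN.
have [d ->] : exists d, t = s + d by exists (t - s); ring.
have -> : 2 * s - (s + d) = s - d by ring.
have -> : s - (s + d) = - d by ring.
rewrite /circle_pt cosD sinD cosB sinB cosN.
by apply/rowP => i; rewrite !mxE; ring.
Qed.

Lemma circle_pt_neq0 Q e f t : posdef Q -> orthonormal2 Q e f -> circle_pt e f t != 0.
Proof.
move=> pQ oef; apply/eqP => at0; have := bform_circle_pt t t pQ oef.
by rewrite at0 subrr cos0 bform0l => /eqP; rewrite eq_sym oner_eq0.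
Qed.

Lemma polar_coordinates e f a b : exists r t, [/\ 0 <= r, 0 <= t
  & a *: e + b *: f = r *: circle_pt e f t].
Proof.
pose r := Num.sqrt (a ^+ 2 + b ^+ 2).
have rr : r ^+ 2 = a ^+ 2 + b ^+ 2 by rewrite sqr_sqrtr // addr_ge0 // sqr_ge0.
have r0 : 0 <= r by rewrite sqrtr_ge0.
have [r00|rn0] := eqVneq r 0.
  move: rr; rewrite r00 expr0n /= => /esym/eqP.
  rewrite paddr_eq0 ?sqr_ge0 // !sqrf_eq0 => /andP[/eqP -> /eqP ->].
  by exists 0, 0; split=> //; rewrite !scale0r addr0.
have rpos : 0 < r by rewrite lt_def rn0.
pose t := acos (a / r).
have ar : -1 <= a / r <= 1.
  rewrite -ler_norml normrM normfV (ger0_norm r0) ler_pdivrMr // mul1r.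
  rewrite -sqrtr_sqr ler_wsqrtr // lerDl sqr_ge0 //.
have ct : cos t = a / r by rewrite acosK // in_itv.
have st : sin t = `|b| / r.
  rewrite sin_acos // (_ : 1 - _ = (b / r) ^+ 2); last first.
    by rewrite !exprMn !exprVn rr; field; rewrite -rr sqrf_eq0.
  by rewrite sqrtr_sqr normrM normfV (ger0_norm r0).
have t0 : 0 <= t by apply: acos_ge0.
have [b0|b0] := leP 0 b.
  exists r, t; split=> //.
  by rewrite /circle_pt ct st ger0_norm // scalerDr !scalerA !(mulrC r) !divfK.
exists r, (pi *+ 2 - t); split=> //.
  by rewrite subr_ge0 (le_trans (acos_lepi ar)) // mulr2n lerDl pi_ge0.
rewrite /circle_pt [pi *+ 2 - t]addrC cosD2pi sinD2pi cosN sinN ct st ltr0_norm // mulNr opprK.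
by rewrite scalerDr !scalerA !(mulrC r) !divfK.
Qed.

(** Reflecting the axis at angle (k - 1) t in the axis at angle k t gives the
    axis at angle (k + 1) t. *)
Lemma circle_pt_multiples Q D e f t : posdef Q -> orthonormal2 Q e f ->
  reflection_closed Q D -> D (circle_pt e f 0) -> D (circle_pt e f t) ->
  forall k, D (circle_pt e f (k%:R * t)).
Proof.
move=> pQ oef [_ DZ DR] D0 Dt k.
suff [] : D (circle_pt e f (k%:R * t)) /\ D (circle_pt e f (k.+1%:R * t)) by [].
elim: k => [|k [IH1 IH2]]; first by rewrite mul0r mul1r.
split=> //; have := DR _ _ IH2 IH1; rewrite (refl_circle_pt _ _ pQ oef).
have -> : 2 * (k.+1%:R * t) - k%:R * t = k.+2%:R * t by rewrite !mulrS; ring.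
by move/(DZ (-1)); rewrite scaleN1r opprK oppr_eq0 oner_eq0; exact.
Qed.

(** Every angle t equals k times t / k, which lies in the given arc for k large;
    so no approximation of angles and no closedness of D is involved. *)
Lemma short_arc_full_plane Q D e f eps : posdef Q -> orthonormal2 Q e f ->
  reflection_closed Q D -> 0 < eps ->
  (forall t, 0 <= t -> t < eps -> D (circle_pt e f t)) ->
  forall a b, a *: e + b *: f != 0 -> D (a *: e + b *: f).
Proof.
move=> pQ oef rD e0 De a b; have [_ DZ _] := rD.
have [r [t [r0 t0 ->]]] := polar_coordinates e f a b.
rewrite scaler_eq0 negb_or => /andP[rn0 _]; apply: DZ => //.
pose k := Num.bound (t / eps).
have tk : t / eps < k%:R by rewrite archi_boundP // divr_ge0 // ltW.
have k0 : 0 < k%:R :> R by apply: le_lt_trans tk; rewrite divr_ge0 // ltW.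
have -> : t = k%:R * (t / k%:R) by rewrite mulrC divfK // gt_eqF.
apply: (circle_pt_multiples pQ oef rD); apply: De => //.
  by rewrite divr_ge0 // ltW.
by rewrite ltr_pdivrMr // mulrC -ltr_pdivrMr.
Qed.

(** A point of the open set and any other vector span a plane that meets the
    open set in a neighbourhood of that point, hence in an arc. *)
Lemma open_axes_full Q D O u : posdef Q -> reflection_closed Q D ->
  open O -> O u -> O `<=` D -> forall w, w != 0 -> D w.
Proof.
move=> pQ rD oO Ou OD w w0; have [Dn0 DZ _] := rD.
have u0 := Dn0 _ (OD _ Ou).
have [[a wa]|wu] := pselect (exists a, w = a *: u).
  rewrite wa; apply: DZ (OD _ Ou); apply: contra w0 => /eqP a0.
  by rewrite wa a0 scale0r.
have {}wu a : w != a *: u by apply/eqP => wa; apply: wu; exists a.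
have [e [f [r [a [b [oef r0 b0 ue we]]]]]] := orthonormal2_exists pQ u0 wu.
have ce : {for 0, continuous (fun t => r *: circle_pt e f t)}.
  apply: mx_continuous => i j.
  have -> : (fun t => (r *: circle_pt e f t) i j) =
      (fun t => r * (cos t * e i j + sin t * f i j)).
    by apply/funext => t; rewrite !mxE.
  apply: continuousM; first exact: cst_continuous.
  apply: continuousD; apply: continuousM; try exact: cst_continuous.
    exact: continuous_cos.
  exact: continuous_sin.
have : \forall t \near (0 : R), O (r *: circle_pt e f t).
  apply: ce; rewrite /circle_pt cos0 sin0 scale1r scale0r addr0 -ue.
  exact: open_nbhs_nbhs.
move=> /nbhs_ballP[eps /= eps0 Oeps].
move: w0; rewrite we; apply: (short_arc_full_plane pQ oef rD eps0) => t t0 te.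
have -> : circle_pt e f t = r^-1 *: (r *: circle_pt e f t).
  by rewrite scalerA mulVf ?scale1r // gt_eqF.
apply: DZ; first by rewrite invr_eq0 gt_eqF.
by apply/OD/Oeps; rewrite /ball /= sub0r normrN ger0_norm.
Qed.

End Arcs.

(** * Lines, hyperplanes and the topology of the Grassmannians *)

Section Hyperplanes.
Context (R : realType) (n : nat).
Implicit Types (K D O : set 'rV[R]_n) (Q : 'M[R]_n) (c x y z u v w g a h p : 'rV[R]_n).
Implicit Types (H G : grassmannian R n.-1 n).

Let hyperplane_line H u : u \notin val H ->
  (<[u]> :&: val H)%VS = 0%VS /\ (<[u]> + val H)%VS = fullv.
Proof.
move=> uH; have u0 : u != 0 by apply: contra uH => /eqP ->; exact: mem0v.
have disj : (<[u]> :&: val H)%VS = 0%VS.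
  apply/eqP; rewrite -subv0; apply/subvP => x; rewrite memv_cap => /andP[].
  move=> /vlineP[t ->] tH; rewrite memv0; apply: contraTT tH => tu.
  apply: contra uH => tH; have t0 : t != 0 by apply: contra tu => /eqP ->; rewrite scale0r.
  by rewrite -[u]scale1r -(mulVf t0) -scalerA memvZ.
split=> //; apply/eqP; rewrite eqEdim subvf /= dimv_disjoint_sum // dim_vline u0.
rewrite (eqP (valP H)) dimvf /dim /= mul1n; by case: (n).
Qed.

Lemma hyperplane_decomp H u x : u \notin val H ->
  exists h t, h \in val H /\ x = h + t *: u.
Proof.
move=> /hyperplane_line[_ full]; have : x \in fullv by exact: memvf.
rewrite -full => /memv_addP[_ /vlineP[t ->] [h hH ->]].
by exists h, t; rewrite addrC.
Qed.

(** The coordinate along u in the decomposition of the space as the direct sum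
    of the line of u and H is a linear form, and a represents it. *)
Lemma hyperplane_normal H u : u \notin val H ->
  exists a, dotp a u = 1 /\ forall x, x \in val H -> dotp a x = 0.
Proof.
move=> uH; have [disj _] := hyperplane_line uH.
have /rV0Pn[j uj] : u != 0 by apply: contra uH => /eqP ->; exact: mem0v.
pose f := daddv_pi <[u]> (val H).
pose a := \row_i (f (delta_mx 0 i) 0 j / u 0 j).
have aE x : dotp a x = f x 0 j / u 0 j.
  rewrite {2}[x]row_sum_delta linear_sum summxE mulr_suml.
  apply: eq_bigr => i _; rewrite linearZ !mxE; ring.
exists a; split; first by rewrite aE daddv_pi_id ?memv_line // divff.
move=> x xH; rewrite aE.
have : f x + daddv_pi (val H) <[u]> x = x.
  by apply: daddv_pi_add => //; apply: (subvP (addvSr _ _)).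
rewrite [daddv_pi (val H) _ _]daddv_pi_id ?[(_ :&: <[u]>)%VS]capvC // => /eqP.
by rewrite -subr_eq0 addrK => /eqP ->; rewrite mxE mul0r.
Qed.

Lemma mem_row_span k (A : 'M[R]_(k, n)) x :
  (x \in row_span A) <-> exists r : 'rV[R]_k, x = r *m A.
Proof.
split.
  move=> /coord_span xE; exists (\row_i coord [tuple row i A | i < k] i x).
  rewrite mulmx_sum_row {1}xE; apply: eq_bigr => i _.
  by rewrite mxE nth_mktuple.
move=> [r ->]; rewrite mulmx_sum_row; apply: memv_suml => i _.
apply/memvZ/memv_span/tnthP; exists i; by rewrite tnth_mktuple.
Qed.

Lemma frame_span_surj k (V : grassmannian R k n) :
  exists F : frame R k n, frame_span F = V.
Proof.
have dV : \dim (val V) = k by apply/eqP; exact: (valP V).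
pose A : 'M[R]_(k, n) := \matrix_(i < k) (vbasis (val V))`_i.
have AE : [tuple row i A | i < k] = vbasis (val V) :> seq _.
  apply: (@eq_from_nth _ 0); rewrite !size_tuple ?dV // => i ik.
  by rewrite -[i]/(nat_of_ord (Ordinal ik)) nth_mktuple rowK.
have fA : row_free A.
  rewrite -kermx_eq0; apply/eqP/row_matrixP => i; rewrite row0.
  set v := row i _; have vA : v *m A = 0 by rewrite -row_mul mulmx_ker row0.
  move: v vA => v vA.
  have fX : free [tuple row i A | i < k].
    by rewrite AE; exact: (basis_free (vbasisP _)).
  apply/rowP => j; rewrite mxE; apply: ((freeP fX) (fun j => v 0 j)).
  rewrite -[RHS]vA mulmx_sum_row; apply: eq_bigr => l _.
  by rewrite nth_mktuple.
exists (exist _ A (mem_set fA)); apply/val_inj => /=.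
by rewrite /row_span AE; exact: (span_basis (vbasisP _)).
Qed.

Let frame_open k (U : set (grassmannian R k n)) : open U ->
  exists2 W : set 'M[R]_(k, n), open W &
    forall F : frame R k n, W (set_val F) <-> U (frame_span F).
Proof.
rewrite open_grassmannianE => -[W oW WU]; exists W => // F.
by rewrite -[U _]/((@frame_span R k n @^-1` U) F) -WU.
Qed.

Lemma open_nonzero : open [set u : 'rV[R]_n | u != 0].
Proof.
have -> : [set u : 'rV[R]_n | u != 0] = (fun u => dotp u u) @^-1` [set t | t != 0].
  by apply/seteqP; split=> u; rewrite /= dotp_eq0.
apply: open_comp; last exact: open_neq.
by move=> u _; apply: dotp_continuous; exact: cvg_id.
Qed.

(** Frames of lines are nonzero vectors, so that an open set of lines is
    directly an open set of vectors. *)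
Lemma thick_lines (S : set (grassmannian R 1 n)) : thick S ->
  exists2 O, open O /\ O !=set0 & forall u, O u -> u != 0 /\
    exists l, S l /\ u \in val l.
Proof.
move=> [U [oU [l0 Ul0] US]]; have [W oW WU] := frame_open oU.
exists (W `&` [set u | u != 0]).
  split.
    by apply: openI => //; exact: open_nonzero.
  have [F0 F0l0] := frame_span_surj l0; exists (set_val F0).
  split; first by apply/WU; rewrite F0l0.
  apply/eqP => F00; have : row_free (set_val F0) by exact: set_valP F0.
  by rewrite F00 /row_free mxrank0.
move=> u [Wu u0]; split=> //.
have fu : row_free u by rewrite /row_free rank_rV u0.
pose F : frame R 1 n := exist _ u (mem_set fu).
exists (frame_span F); split; first by apply/US/WU.
by apply/mem_row_span; exists 1%:M; rewrite mul1mx.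
Qed.

(** Hyperplanes are given by frames, whereas the proof needs normals.  Around a
    frame B0 with normal g0, projecting the rows of B0 along g0 to the
    orthogonal complement of g gives a frame B g of that complement which
    depends continuously on g and equals B0 at g0. *)
Lemma thick_hyperplanes (S : set (grassmannian R n.-1 n)) : (0 < n)%N -> thick S ->
  exists2 O, open O /\ O !=set0 & forall g, O g -> g != 0 /\
    exists2 G, S G & forall x, x \in val G <-> dotp g x = 0.
Proof.
move=> n0 [U [oU [G0 UG0] US]]; have [W oW WU] := frame_open oU.
have [F0 F0G0] := frame_span_surj G0; pose B0 := set_val F0.
have fB0 : row_free B0 by exact: set_valP F0.
have [g0 g00 B0g0] : exists2 g0 : 'rV[R]_n, g0 != 0 & B0 *m g0^T = 0.
  by apply: row_space_normal; rewrite (eqP fB0) ltn_predL.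
pose B g : 'M[R]_(n.-1, n) := B0 - (B0 *m g^T) *m ((dotp g0 g)^-1 *: g0).
have Bg0 : B g0 = B0 by rewrite /B B0g0 mul0mx subr0.
have Bfree g : dotp g0 g != 0 -> row_free (B g).
  move=> gg; rewrite -kermx_eq0; apply/rowV0P => v /sub_kermxP.
  rewrite mulmxBr mulmxA -scalemxAr => /eqP; rewrite subr_eq0 => /eqP vB.
  have v0 : v *m (B0 *m g^T) = 0.
    have : v *m B0 *m g0^T = 0 by rewrite -mulmxA B0g0 mulmx0.
    rewrite vB -scalemxAl -mulmxA => /eqP; rewrite scaler_eq0 invr_eq0 (negbTE gg) /=.
    rewrite [g0 *m _]mx11_scalar -dotpE mul_mx_scalar scaler_eq0 => /orP[|/eqP//].
    by rewrite dotp_eq0 (negbTE g00).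
  apply: (row_free_inj fB0); rewrite mul0mx vB v0 mul0mx scaler0 //.
have Bg g : dotp g0 g != 0 -> B g *m g^T = 0.
  move=> gg; rewrite mulmxBl -(mulmxA (B0 *m g^T)) -scalemxAl [g0 *m _]mx11_scalar -dotpE.
  by rewrite scale_scalar_mx mulVf // mulmx1 subrr.
pose O' := [set g | dotp g0 g != 0 /\ W (B g)].
exists (O'^°).
  split; first exact: open_interior.
  exists g0; rewrite /interior /O' /=.
  have cg : {for g0, continuous (fun g => dotp g0 g)}.
    by apply: dotp_continuous; [exact: cst_continuous_at|exact: cvg_id].
  have cB : {for g0, continuous B}.
    apply: mx_continuous => i j.
    have -> : (fun g => B g i j) =
       (fun g => B0 i j - dotp (row i B0) g * ((dotp g0 g)^-1 * g0 0 j)).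
      apply/funext => g; rewrite !mxE big_ord1 !mxE; congr (_ - _ * _).
      by apply: eq_bigr => k _; rewrite !mxE.
    have c1 : {for g0, continuous (fun g => dotp (row i B0) g)}.
      by apply: dotp_continuous; [exact: cst_continuous_at|exact: cvg_id].
    have c2 : {for g0, continuous (fun g => (dotp g0 g)^-1)}.
      by apply: (continuousV _ cg); rewrite dotp_eq0.
    exact: (continuousB (@cst_continuous_at _ _ (B0 i j) g0)
      (continuousM c1 (continuousM c2 (@cst_continuous_at _ _ (g0 0 j) g0)))).
  have n1 : \forall g \near g0, dotp g0 g != 0.
    apply: (cg [set t | t != 0]); apply: open_nbhs_nbhs.
    by split; [exact: open_neq|rewrite /= dotp_eq0].
  have n2 : \forall g \near g0, W (B g).
    apply: (cB W); apply: open_nbhs_nbhs; split => //.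
    by rewrite Bg0; apply/WU; rewrite F0G0.
  by near=> g; split; near: g.
move=> g /interior_subset[gg Wg].
have gn0 : g != 0 by apply: contra gg => /eqP ->; rewrite dotp0r.
split=> //.
pose F : frame R n.-1 n := exist _ (B g) (mem_set (Bfree g gg)).
have Gg x : x \in val (frame_span F) -> dotp g x = 0.
  by move=> /mem_row_span[r ->] /=; rewrite dotpC dotpE -mulmxA Bg // mulmx0 mxE.
exists (frame_span F); first by apply/US/WU.
move=> x; split; first exact: Gg.
move=> gx; apply: contraPT gn0 => xG.
move/negP; apply; rewrite -dotp_eq0.
have [h [t [hG {2}->]]] := hyperplane_decomp g xG.
by rewrite dotpDr dotpZr gx Gg // mulr0 addr0.
Unshelve. all: by end_near. Qed.

End Hyperplanes.

(** * Affine reflections of a convex body *)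

Section BodyReflections.
Context (R : realType) (n : nat).
Implicit Types (K D O : set 'rV[R]_n) (Q : 'M[R]_n) (c x y z u v w g a h p : 'rV[R]_n).
Implicit Types (H G : grassmannian R n.-1 n) (l : grassmannian R 1 n).

Definition invariant_pair K Q c : Prop :=
  [/\ posdef Q, K c & forall M b, affine_symmetry K M b ->
    c *m M + b = c /\ M *m Q *m M^T = Q].

(** The reflection with direction u whose mirror is the hyperplane through p on
    which a is constant, under the normalisation [dotp a u = 1]. *)
Definition skew_reflection a u p x : 'rV[R]_n := x - (2 * dotp a (x - p)) *: u.

Lemma skew_reflectionK a u p : dotp a u = 1 ->
  involutive (skew_reflection a u p).
Proof.
move=> au x; rewrite /skew_reflection -addrA -opprD -scalerDl.
rewrite [X in X *: _](_ : _ = 0) ?scale0r ?subr0 //.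
by rewrite !dotp_lin au; ring.
Qed.

(** Being an affine symmetry of K, the reflection fixes c, so its mirror passes
    through c; and its linear part preserves Q, so its mirror is the
    Q-orthogonal complement of u. *)
Lemma skew_reflection_axes K Q c a u p : invariant_pair K Q c ->
  dotp a u = 1 -> (forall x, K x -> K (skew_reflection a u p x)) ->
  axes K Q c u /\ forall x, bform Q x u = dotp a x * bform Q u u.
Proof.
move=> [pQ Kc inv] au sK; have [sQ _] := pQ.
have u0 : u != 0.
  by apply/eqP => u0; move: au; rewrite u0 dotp0r => /eqP; rewrite eq_sym oner_eq0.
pose M : 'M[R]_n := 1%:M - 2 *: (a^T *m u); pose b := (2 * dotp a p) *: u.
have xM x : x *m M = x - (2 * dotp a x) *: u.
  rewrite mulmxBr mulmx1 -scalemxAr mulmxA [x *m _]mx11_scalar -dotpE.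
  by rewrite mul_scalar_mx scalerA (dotpC x).
have xMb x : x *m M + b = skew_reflection a u p x.
  rewrite xM /skew_reflection dotpBr mulrBr scalerBl opprB /b.
  by rewrite -addrA; congr (_ + _); rewrite addrC.
have MM : M *m M = 1%:M.
  apply/row_matrixP => i; rewrite row_mul !rowE mulmx1 -mulmxA.
  rewrite mulmxA !xM !dotp_lin au -addrA -opprD -scalerDl.
  rewrite [X in X *: _](_ : _ = 0) ?scale0r ?subr0 //; ring.
have sM : affine_symmetry K M b.
  split; first by case: (mulmx1_unit MM).
  by move=> x; rewrite xMb; split=> [/sK|/sK//]; rewrite skew_reflectionK.
have [cM QM] := inv _ _ sM.
have acp : dotp a (c - p) = 0.
  move: cM; rewrite xMb /skew_reflection => /eqP.
  rewrite -subr_eq0 addrAC subrr add0r oppr_eq0 scaler_eq0 (negbTE u0) orbF.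
  by rewrite mulf_eq0 pnatr_eq0 => /eqP.
have formE x : bform Q x u = dotp a x * bform Q u u.
  have := bform_mul M Q x u; rewrite QM !xM au !bform_lin.
  rewrite (_ : 2 * 1 = 1 + 1); last by ring.
  by move=> h; lra.
split=> //; split=> // x Kx.
have -> : c + refl Q u x = skew_reflection a u p (c + x); last exact: sK.
rewrite /skew_reflection /refl formE mulrA mulfK; last exact: posdef_neq0.
by rewrite -[c + x - p]addrAC dotpDr acp add0r addrA.
Qed.

Lemma line_span l u : u \in val l -> u != 0 -> val l = <[u]>%VS.
Proof.
move=> ul u0; apply/esym/eqP; rewrite eqEdim -memvE ul /=.
by rewrite dim_vline u0 (eqP (valP l)).
Qed.

Lemma reflection_skew r l p H u : is_reflection r l p H ->
  u \in val l -> u != 0 ->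
  exists a, [/\ dotp a u = 1, forall x, x \in val H <-> dotp a x = 0 &
    r =1 skew_reflection a u p].
Proof.
move=> [lH rP] ul u0; have lE := line_span ul u0.
have uH : u \notin val H by apply: contra lH; rewrite lE -memvE.
have [a [au aH]] := hyperplane_normal uH; exists a; split=> //.
  move=> x; split; first exact: aH.
  have [h [t [hH ->]]] := hyperplane_decomp x uH.
  rewrite dotpDr dotpZr aH // au add0r mulr1 => ->.
  by rewrite scale0r addr0.
move=> x; have [h [t [hH xp]]] := hyperplane_decomp (x - p) uH.
have -> : x = (p + h) + t *: u by rewrite -addrA -xp addrC subrK.
rewrite rP; first last.
- by rewrite lE memvZ // memv_line.
- by rewrite /affine_subspace /= addrAC subrr add0r.
rewrite /skew_reflection (_ : p + h + t *: u - p = h + t *: u); last first.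
  by rewrite addrAC [p + h]addrC addrK.
rewrite dotpDr dotpZr aH // au add0r mulr1 -[RHS]addrA -scalerBl.
by rewrite -scaleNr; congr (_ + _ *: _); ring.
Qed.

Lemma reflection_axes K Q c r l p H u : invariant_pair K Q c ->
  is_reflection r l p H -> r @` K = K -> u \in val l -> u != 0 ->
  axes K Q c u /\ forall x, x \in val H <-> bform Q x u = 0.
Proof.
move=> iK rr rK ul u0; have [a [au aH ra]] := reflection_skew rr ul u0.
have [|ax formE] := skew_reflection_axes iK au (p := p).
  by move=> x Kx; rewrite -ra -rK; exists x.
split=> // x; rewrite aH formE.
have /posdef_neq0/(_ u0) uu : posdef Q by case: iK.
split=> [->|/eqP]; first by rewrite mul0r.
by rewrite mulf_eq0 (negbTE uu) orbF => /eqP.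
Qed.

(** The mirror has normal u Q.  The ground condition says that u is orthogonal
    to every vector orthogonal to both u Q and g, so u lies in their span; since
    u is orthogonal to g, it cannot be a multiple of g, and u Q lies in the span
    of u and g.  Were al zero, u would be orthogonal to the mirror. *)
Lemma ground_axes K Q c G g : invariant_pair K Q c ->
  nonorthogonal_ground_hyperplanes K G -> g != 0 ->
  (forall x, x \in val G <-> dotp g x = 0) ->
  exists u al be, [/\ axes K Q c u, al != 0, dotp g u = 0 &
    u *m Q = be *: u + al *: g].
Proof.
move=> iK [r [l [p [H [rr rK nort [lG ort]]]]]] g0 Gg.
have [u ul u0] : exists2 u, u \in val l & u != 0.
  exists (vpick (val l)); first exact: memv_pick.
  by rewrite vpick0 -dimv_eq0 (eqP (valP l)).
have lE := line_span ul u0.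
have [ax HQ] := reflection_axes iK rr rK ul u0.
have [[sQ pos] _ _] := iK; have uu := pos _ u0.
have uH : u \notin val H by apply/negP => /HQ/eqP; rewrite gt_eqF.
have uG : u \in val G by apply: (subvP lG).
have gu : dotp g u = 0 by apply/Gg.
have ud : 0 < dotp u u by apply: dotp_gt0.
have gd : 0 < dotp g g by apply: dotp_gt0.
(* u is orthogonal to the directions common to H and G *)
have uHG z : z \in val H -> z \in val G -> dotp u z = 0.
  move=> zH zG; have [h [t [hH pE]]] := hyperplane_decomp (- p) uH.
  have m0 : affine_subspace p (val H) (- t *: u).
    by rewrite /affine_subspace /= pE addrC scaleNr addrK.
  have mG : - t *: u \in val G by rewrite memvZ.
  have := ort u (- t *: u + z) (- t *: u) ul.
  rewrite addrAC subrr add0r; apply; split=> //=; last by rewrite memvD.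
  by rewrite /affine_subspace /= addrAC memvD.
(* be and al are the coefficients of the projection of u Q to the span of the
   orthogonal vectors u and g, and k is the remainder. *)
pose be := bform Q u u / dotp u u.
pose al := dotp g (u *m Q - be *: u) / dotp g g.
pose k := u *m Q - be *: u - al *: g.
have uk : dotp u k = 0.
  rewrite /k !dotp_lin (dotpC u g) gu mulr0 subr0 dotpC -/(bform Q u u) /be divfK ?subrr //.
  by rewrite gt_eqF.
have gk : dotp g k = 0.
  by rewrite /k !dotpBr dotpZr /al divfK ?gt_eqF // -dotpBr subrr.
have k0 : k = 0.
  apply/eqP; rewrite -dotp_eq0.
  have Quk : bform Q u k = dotp k k.
    have -> : bform Q u k = dotp (k + al *: g + be *: u) k by rewrite /k !subrK.
    by rewrite !dotpDl !dotpZl uk gk !mulr0 !addr0.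
  (* z is the combination of u and k orthogonal to u Q *)
  pose z := dotp k k *: u - bform Q u u *: k.
  have : dotp u z = 0.
    apply: uHG.
      by apply/HQ; rewrite bformC // /z bformDr bformNr !bformZr Quk mulrC subrr.
    by apply/Gg; rewrite /z dotpBr !dotpZr gu gk !mulr0 subrr.
  rewrite /z dotpBr !dotpZr uk mulr0 subr0 => /eqP.
  by rewrite mulf_eq0 (gt_eqF ud) orbF.
have uQ : u *m Q = be *: u + al *: g.
  by apply/eqP; rewrite -subr_eq0 opprD addrA -/k k0.
exists u, al, be; split=> //; apply/eqP => al0; apply: nort.
move=> v x y; rewrite lE => /vlineP[t ->] xH yH.
have be0 : 0 < be by rewrite divr_gt0.
have : x - y \in val H.
  have -> : x - y = (x - p) - (y - p) by rewrite opprB addrA subrK.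
  exact: memvB.
move/HQ; rewrite bformC // /bform uQ al0 scale0r addr0 dotpZl => /eqP.
by rewrite mulf_eq0 (gt_eqF be0) /= dotpZl => /eqP ->; rewrite mulr0.
Qed.

End BodyReflections.

(** * Flat midpoint sets give reflections *)

Section FlatMidpoints.
Context (R : realType) (n : nat).
Implicit Types (K : set 'rV[R]_n) (c x y z u v w a h p : 'rV[R]_n).
Implicit Types (H : grassmannian R n.-1 n) (l : grassmannian R 1 n).

Lemma chord_parameters K x u : convex_body K -> u != 0 -> K x ->
  exists al be : R, [/\ al <= 0, 0 <= be &
    forall t, K (x + t *: u) <-> al <= t <= be].
Proof.
move=> bK u0 Kx; have [cK _ _] := bK.
have [B B0 BK] := convex_body_bounded bK.
pose T := [set t : R | K (x + t *: u)].
have clT : closed T.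
  apply: (@closed_comp _ _ (fun t : R => x + t *: u) K).
    by move=> t _; exact: line_continuous.
  exact: compact_closed cK.
pose N := (B + `|x|) / `|u|.
have TN : T `<=` `[- N, N]%classic.
  move=> t /BK xt; rewrite /= in_itv /= -ler_norml ler_pdivlMr ?normr_gt0 //.
  rewrite -normrZ -[t *: u](addKr x) addrC.
  by apply: le_trans (ler_normB _ _) _; rewrite lerD2r.
have kT : compact T by exact: subclosed_compact clT (@segment_compact _ _ _) TN.
have T0 : T 0 by rewrite /T /= scale0r addr0.
have [be] : exists2 b, b \in T & forall t, t \in T -> t <= b.
  apply: (@compact_EVT_max _ R id) => //; first by exists 0.
  by apply: continuous_subspaceT => t; exact: cvg_id.
have [al] : exists2 b, b \in T & forall t, t \in T -> b <= t.
  apply: (@compact_EVT_min _ R id) => //; first by exists 0.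
  by apply: continuous_subspaceT => t; exact: cvg_id.
rewrite !inE => Tal alP Tbe beP; exists al, be; split.
- by apply: alP; rewrite inE.
- by apply: beP; rewrite inE.
move=> t; split=> [Tt|/andP[at_ tb]].
  by rewrite alP ?inE // beP ?inE.
have [ab|ab] := eqVneq al be.
  by have -> : t = al by apply/eqP; rewrite eq_le at_ ab tb.
have abp : 0 < be - al by rewrite subr_gt0 lt_neqAle ab (le_trans at_).
have := @convex_bodyP _ _ K (x + al *: u) (x + be *: u) ((t - al) / (be - al)) bK.
set s := _ / _.
have -> : (1 - s) *: (x + al *: u) + s *: (x + be *: u) = x + t *: u.
  rewrite !scalerDr addrACA -scalerDl subrK scale1r !scalerA -scalerDl.
  by congr (_ + _ *: _); rewrite /s; field; rewrite gt_eqF.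
apply=> //; rewrite /s divr_ge0 ?subr_ge0 ?(le_trans at_) //=.
by rewrite ler_pdivrMr // mul1r lerD2r.
Qed.

Lemma chord_midpointE K l x u al be : u != 0 -> val l = <[u]>%VS ->
  (forall t, K (x + t *: u) <-> al <= t <= be) -> al < be ->
  chord_midpoint K l (x + ((al + be) / 2) *: u).
Proof.
move=> u0 lE Kt ab; exists x, (x + al *: u), (x + be *: u); split.
- rewrite -subr_eq0 opprD addrACA subrr add0r -scalerBl scaler_eq0.
  by rewrite (negbTE u0) orbF subr_eq0 lt_eqF.
- have abp : 0 < be - al by rewrite subr_gt0.
  apply/seteqP; split=> y.
    move=> [Ky]; rewrite /affine_subspace /= lE => /vlineP[t yx].
    have yE : y = x + t *: u by rewrite -yx addrC subrK.
    move: Ky; rewrite yE => /Kt/andP[at_ tb].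
    exists ((t - al) / (be - al)) => /=.
      rewrite divr_ge0 ?subr_ge0 ?(ltW ab) //=.
      by rewrite ler_pdivrMr // mul1r lerD2r.
    rewrite !scalerDr addrACA -scalerDl subrK scale1r !scalerA -scalerDl.
    by congr (_ + _ *: _); field; rewrite gt_eqF.
  move=> [s /= /andP[s0 s1] <-].
  have -> : (1 - s) *: (x + al *: u) + s *: (x + be *: u) =
      x + (al + s * (be - al)) *: u.
    rewrite !scalerDr addrACA -scalerDl subrK scale1r !scalerA -scalerDl.
    by congr (_ + _ *: _); ring.
  split.
    apply/Kt; rewrite lerDl mulr_ge0 ?(ltW abp) //=.
    by rewrite -lerBrDl ler_piMl // ltW.
  by rewrite /affine_subspace /= addrAC subrr add0r lE memvZ // memv_line.
- rewrite addrACA -scalerDl scalerDr scalerA mulrC.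
  by rewrite -mulr2n -[x *+ 2]scaler_nat scalerA mulVf ?scale1r // pnatr_eq0.
Qed.

(** On a nondegenerate chord, the reflection in the midpoint hyperplane is the
    central symmetry of the chord.  Points of K whose chord degenerates are
    limits of points with nondegenerate chords, obtained by moving towards an
    interior point. *)
Lemma flat_midpoint_skew K l u : convex_body K -> flat_midpoint_lines K l ->
  u \in val l -> u != 0 ->
  exists a p, dotp a u = 1 /\ forall x, K x -> K (skew_reflection a u p x).
Proof.
move=> bK [p [H mid]] ul u0; have lE := line_span ul u0.
have [x0 [r [Kx0 r0 rK]]] := convex_body_interior bK.
have nu : 0 < `|u| by rewrite normr_gt0.
have mid_chord x s : K x -> s != 0 -> K (x + s *: u) ->
    exists al be, [/\ al <= 0, 0 <= be, forall t, K (x + t *: u) <-> al <= t <= be &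
      x + ((al + be) / 2) *: u - p \in val H].
  move=> Kx s0 Kxs; have [al [be [a0 b0 Kt]]] := chord_parameters bK u0 Kx.
  exists al, be; split=> //; apply: (mid (x + ((al + be) / 2) *: u)).
  apply: chord_midpointE => //; have /Kt/andP[s1 s2] := Kxs.
  rewrite lt_neqAle (le_trans a0) // andbT; apply: contra s0 => /eqP ab.
  by apply/eqP/le_anti; rewrite (le_trans s2) -?ab // (le_trans _ s1) // ab.
(* Otherwise the midpoint hyperplane would contain each chord along with its
   midpoint, hence an open set. *)
have uH : u \notin val H.
  apply/negP => uH.
  have small v : `|v| <= r / 2 -> x0 + v - p \in val H.
    move=> vr; pose s := r / 2 / `|u|.
    have s0 : s != 0 by rewrite gt_eqF // !divr_gt0.
    have su : `|s *: u| = r / 2.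
      by rewrite normrZ gtr0_norm ?divr_gt0 // divfK // gt_eqF.
    have [|||al [be [_ _ _]]] := mid_chord (x0 + v) s.
    - by apply: rK; apply: le_trans vr _; lra.
    - by [].
    - rewrite -addrA; apply: rK; apply: le_trans (ler_normD _ _) _.
      by rewrite su; lra.
    by rewrite addrAC => /memvB/(_ (memvZ ((al + be) / 2) uH)); rewrite addrK.
  have smallH v : `|v| <= r / 2 -> v \in val H.
    move=> vr; have := memvB (small _ vr) (small 0 _).
    rewrite normr0 divr_ge0 ?(ltW r0) // => /(_ isT).
    by rewrite addr0 opprB addrA subrK addrC addKr.
  have : (fullv <= val H)%VS.
    apply/subvP => v _; have [->|v0] := eqVneq v 0; first exact: mem0v.
    have nv : 0 < `|v| by rewrite normr_gt0.
    have -> : v = (`|v| / (r / 2)) *: ((r / 2 / `|v|) *: v).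
      rewrite scalerA (_ : _ * _ = 1) ?scale1r //; field.
      by rewrite !gt_eqF.
    apply/memvZ/smallH; rewrite normrZ gtr0_norm ?divr_gt0 //.
    by rewrite divfK // gt_eqF.
  move=> /dimvS; rewrite (eqP (valP H)) dimvf /dim /= mul1n.
  case: (n) u u0 {ul lE nu mid_chord small smallH uH} => [u|m u _].
    by move=> /eqP[]; apply/rowP => -[].
  by rewrite ltnn.
have [a [au aH]] := hyperplane_normal uH; exists a, p; split=> //.
have skew x s : K x -> s != 0 -> K (x + s *: u) -> K (skew_reflection a u p x).
  move=> Kx s0 Kxs; have [al [be [a0 b0 Kt /aH]]] := mid_chord _ _ Kx s0 Kxs.
  rewrite addrAC dotpDr dotpZr au => h.
  rewrite /skew_reflection -scaleNr (_ : - (2 * _) = al + be); last by lra.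
  by apply/Kt; lra.
move=> x Kx; apply: contrapT => nK.
have [cK _ _] := bK; have clK : closed K by exact: compact_closed.
pose X (t : R) := skew_reflection a u p ((1 - t) *: x + t *: x0).
have XE t : X t = (1 - t) *: skew_reflection a u p x + t *: skew_reflection a u p x0.
  rewrite /X /skew_reflection !scalerBr !scalerA addrACA -opprD -scalerDl.
  by congr (_ - _ *: _); rewrite !dotp_lin; ring.
have cX : {for 0, continuous X}.
  apply: mx_continuous => i j.
  have -> : (fun t => X t i j) = (fun t => skew_reflection a u p x i j +
     t * (skew_reflection a u p x0 i j - skew_reflection a u p x i j)).
    by apply/funext => t; rewrite XE !mxE; ring.
  exact: (continuousD (@cst_continuous_at _ _ _ _)
    (continuousM (@cvg_id _ _) (@cst_continuous_at _ _ _ _))).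
have : \forall t \near (0 : R), (~` K) (X t).
  apply: (cX (~` K)); apply: open_nbhs_nbhs; split; first by rewrite openC.
  by rewrite XE subr0 scale1r scale0r addr0.
move=> /nbhs_ballP[e /= e0 eX].
pose t := Num.min (e / 2) 1.
have t0 : 0 < t by rewrite lt_min ltr01 divr_gt0.
have t1 : t <= 1 by rewrite ge_min lexx orbT.
have te : t < e by rewrite (@le_lt_trans _ _ (e / 2)) // ?ge_min ?lexx //; lra.
apply: (eX t); first by rewrite /ball /= sub0r normrN gtr0_norm.
apply: (@skew _ (t * (r / `|u|))).
- by apply: convex_bodyP => //; rewrite (ltW t0).
- by rewrite mulf_neq0 // gt_eqF // divr_gt0.
- rewrite -scalerA -addrA -scalerDr; apply: convex_bodyP => //.
    by rewrite (ltW t0).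
  by apply: rK; rewrite normrZ gtr0_norm ?divr_gt0 // divfK // gt_eqF.
Qed.

End FlatMidpoints.

(** * Accumulating axes fill a plane *)

Section SmallAngles.
Context (R : realType) (n : nat).
Implicit Types (D : set 'rV[R]_n) (Q : 'M[R]_n) (x y z u v w e f : 'rV[R]_n).

Lemma sphere_compact Q : posdef Q -> compact [set x | bform Q x x = 1].
Proof.
move=> /posdef_factor[P uP ->]; apply: bounded_closed_compact.
  exists `|n%:R * `|invmx P| |; split; first exact: num_real.
  move=> t lt x /=; rewrite /bform mulmxA dotp_mull trmxK => x1.
  apply: le_trans (ltW lt); apply: le_trans (ler_norm _).
  rewrite -[x](mulmxK uP); apply: le_trans (norm_mulmx_le _ _) _.
  rewrite ler_wpM2l // ler_piMl //.
  rewrite -(@expr_le1 _ 2) // -x1; exact: norm_sqr_le_dotp.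
apply: (@closed_comp _ _ (fun x => bform (P *m P^T) x x) [set t | t = 1]);
  last exact: closed_eq.
move=> x _; have h : {for x, continuous (@id 'rV[R]_n)} by exact: cvg_id.
exact: (bform_continuous (@cst_continuous_at _ _ (P *m P^T) x) h h).
Qed.

Let orthonormal_compact Q : posdef Q ->
  compact [set ef : 'rV[R]_n * 'rV[R]_n | orthonormal2 Q ef.1 ef.2].
Proof.
move=> pQ; have sc := sphere_compact pQ.
apply: (@subclosed_compact _ _ ([set x | bform Q x x = 1] `*` [set x | bform Q x x = 1])).
- have -> : [set ef | orthonormal2 Q ef.1 ef.2] =
     ([set ef : 'rV[R]_n * 'rV[R]_n | bform Q ef.1 ef.1 = 1] `&`
     [set ef | bform Q ef.2 ef.2 = 1]) `&` [set ef | bform Q ef.1 ef.2 = 0].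
    by apply/seteqP; split=> -[e f] /=; [case|move=> [[]]]; split.
  have c1 (ef : 'rV[R]_n * 'rV[R]_n) : {for ef, continuous fst} by exact: cvg_fst.
  have c2 (ef : 'rV[R]_n * 'rV[R]_n) : {for ef, continuous snd} by exact: cvg_snd.
  have cst (ef : 'rV[R]_n * 'rV[R]_n) := @cst_continuous_at _ _ Q ef.
  apply: closedI; first apply: closedI.
  + apply: (@closed_comp _ _ (fun ef : 'rV[R]_n * 'rV[R]_n => bform Q ef.1 ef.1)
      [set t | t = 1]); last exact: closed_eq.
    by move=> ef _; exact: (bform_continuous (cst ef) (c1 ef) (c1 ef)).
  + apply: (@closed_comp _ _ (fun ef : 'rV[R]_n * 'rV[R]_n => bform Q ef.2 ef.2)
      [set t | t = 1]); last exact: closed_eq.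
    by move=> ef _; exact: (bform_continuous (cst ef) (c2 ef) (c2 ef)).
  + apply: (@closed_comp _ _ (fun ef : 'rV[R]_n * 'rV[R]_n => bform Q ef.1 ef.2)
      [set t | t = 0]); last exact: closed_eq.
    by move=> ef _; exact: (bform_continuous (cst ef) (c1 ef) (c2 ef)).
- exact: compact_setX.
- by move=> [e f] [].
Qed.

Let circle_pt_joint_continuous (eft : ('rV[R]_n * 'rV[R]_n) * R) :
  {for eft, continuous (fun s : ('rV[R]_n * 'rV[R]_n) * R => circle_pt s.1.1 s.1.2 s.2)}.
Proof.
apply: mx_continuous => i j.
have -> : (fun s : ('rV[R]_n * 'rV[R]_n) * R => circle_pt s.1.1 s.1.2 s.2 i j) =
   (fun s => cos s.2 * s.1.1 i j + sin s.2 * s.1.2 i j).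
  by apply/funext => s; rewrite !mxE.
have h1 : {for eft, continuous (fun s : ('rV[R]_n * 'rV[R]_n) * R => s.1.1 i j)}.
  apply: coord_comp_continuous.
  by apply: (@continuous_comp _ _ _ fst fst eft); exact: cvg_fst.
have h2 : {for eft, continuous (fun s : ('rV[R]_n * 'rV[R]_n) * R => s.1.2 i j)}.
  apply: coord_comp_continuous.
  by apply: (@continuous_comp _ _ _ fst snd eft); [exact: cvg_fst|exact: cvg_snd].
have h3 : {for eft, continuous (fun s : ('rV[R]_n * 'rV[R]_n) * R => cos s.2)}.
  by apply: (@continuous_comp _ _ _ snd cos eft); [exact: cvg_snd|exact: continuous_cos].
have h4 : {for eft, continuous (fun s : ('rV[R]_n * 'rV[R]_n) * R => sin s.2)}.
  by apply: (@continuous_comp _ _ _ snd sin eft); [exact: cvg_snd|exact: continuous_sin].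
exact: (continuousD (continuousM h3 h1) (continuousM h4 h2)).
Qed.

(** The union of D and the origin is closed. *)
Definition coclosed D : Prop :=
  forall y, y != 0 -> ~ D y -> \forall z \near y, ~ D z.

Definition full_plane D e f : Prop :=
  forall a b, a *: e + b *: f != 0 -> D (a *: e + b *: f).

(** Two axes at angle th generate a th-net of axes in the plane they span.  If no
    plane consists of axes, then each plane has an arc free of axes, and by
    compactness of the set of orthonormal pairs these arcs have a common radius
    del.  This excludes axes at an angle smaller than del. *)
Lemma small_angles_plane Q D : posdef Q -> reflection_closed Q D -> coclosed D ->
  (forall eta, 0 < eta -> exists u v, [/\ D u, D v, bform Q u u = 1,
     bform Q v v = 1 & [/\ u != v, u != - v & bform Q (u - v) (u - v) < eta]]) ->
  exists e f, orthonormal2 Q e f /\ full_plane D e f.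
Proof.
move=> pQ rD cD close; have [sQ _] := pQ; have [Dn0 DZ _] := rD.
apply: contrapT => noplane.
have bad e f : orthonormal2 Q e f -> exists2 t, 0 <= t & ~ D (circle_pt e f t).
  move=> oef; apply: contrapT => nobad; apply: noplane; exists e, f; split=> //.
  move=> a b; have [r [t [r0 t0 ->]]] := polar_coordinates e f a b.
  rewrite scaler_eq0 negb_or => /andP[rn0 _]; apply: DZ => //.
  by apply: contrapT => nD; apply: nobad; exists t.
pose P (del : R) (ef : 'rV[R]_n * 'rV[R]_n) := exists2 t, 0 <= t &
  forall s, `|s - t| <= del -> ~ D (circle_pt ef.1 ef.2 s).
have cov : \forall del \near 0^'+,
    [set ef : 'rV[R]_n * 'rV[R]_n | orthonormal2 Q ef.1 ef.2] `<=` P del.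
  move/compact_near_coveringP : (orthonormal_compact pQ); apply => -[e f] /= oef.
  have [t t0 nD] := bad _ _ oef.
  have : \forall s \near ((e, f), t), ~ D (circle_pt s.1.1 s.1.2 s.2).
    apply: (@circle_pt_joint_continuous ((e, f), t) (fun z => ~ D z)).
    by apply: cD => //; exact: circle_pt_neq0 pQ oef.
  move=> [[A B] /= [Aef /nbhs_ballP[eps /= eps0 Beps]] AB].
  near=> ef' del => /=; exists t => // s st.
  apply: (AB (ef', s)); split => /=; first by near: ef'.
  apply: Beps; rewrite /ball /= distrC; apply: le_lt_trans st _.
  by near: del; exact: nbhs_right_lt.
near (0 : R)^'+ => del.
have del0 : 0 < del by [].
have del_pi : del < pi by near: del; apply: nbhs_right_lt; exact: pi_gt0.
have delP : [set ef : 'rV[R]_n * 'rV[R]_n | orthonormal2 Q ef.1 ef.2] `<=` P del.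
  exact: (near cov del).
have cdel : cos del < 1.
  rewrite -cos0 ltr_cos ?in_itv /= ?lexx ?pi_ge0 ?(ltW del0) ?(ltW del_pi) //.
have [|u [v [Du Dv uu vv [uv uNv uveta]]]] := close (2 - 2 * cos del); first by lra.
have vu a : v != a *: u.
  apply/eqP => va; have : a ^+ 2 = 1.
    by have := vv; rewrite va !bform_lin uu mulr1 expr2.
  move/eqP; rewrite sqrf_eq1 => /orP[]/eqP a1; move: uv uNv; rewrite va a1.
    by rewrite scale1r eqxx.
  by rewrite scaleN1r opprK eqxx.
have [e [f [r [a [b [oef r0 b0 ue ve]]]]]] := orthonormal2_exists pQ (Dn0 _ Du) vu.
have [ee ff ef] := oef.
have r1 : r = 1.
  have : r ^+ 2 = 1 by have := uu; rewrite ue !bform_lin ee mulr1 expr2.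
  by move/eqP; rewrite sqrf_eq1 => /orP[]/eqP // rN; move: r0; rewrite rN; lra.
have ab1 : a ^+ 2 + b ^+ 2 = 1.
  have := vv; rewrite ve !bform_lin ee ff ef (bformC f e sQ) ef => <-; ring.
have a2 : `|a| <= 1.
  rewrite -(@expr_le1 _ 2) // real_normK ?num_real //.
  by have := sqr_ge0 b; lra.
have aitv : -1 <= a <= 1 by rewrite -ler_norml.
pose th := acos a.
have cth : cos th = a by rewrite acosK // in_itv.
have sth : sin th = b.
  rewrite sin_acos // (_ : 1 - _ = b ^+ 2); last by lra.
  by rewrite sqrtr_sqr gtr0_norm.
have th0 : 0 <= th by apply: acos_ge0.
have thpi : th <= pi by apply: acos_lepi.
have thpos : 0 < th.
  rewrite lt_def th0 andbT; apply/eqP => th00; move: sth b0.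
  by rewrite th00 sin0 => <-; rewrite ltxx.
have thdel : th < del.
  rewrite -ltr_cos ?in_itv /= ?th0 ?thpi ?(ltW del0) ?(ltW del_pi) // cth.
  move: uveta; rewrite !bform_lin uu vv (bformC v u sQ).
  have -> : bform Q u v = a by rewrite ue ve r1 scale1r !bform_lin ee ef; ring.
  lra.
have D0 : D (circle_pt e f 0).
  by rewrite /circle_pt cos0 sin0 scale1r scale0r addr0 -[e]scale1r -{1}r1 -ue.
have Dth : D (circle_pt e f th) by rewrite /circle_pt cth sth -ve.
have [t t0 /=] := delP (e, f) oef.
have /andP[k1 k2] : (Num.truncn (t / th))%:R <= t / th < (Num.truncn (t / th)).+1%:R.
  by apply: truncn_itv; rewrite divr_ge0.
apply; last exact: (circle_pt_multiples pQ oef rD D0 Dth (Num.truncn (t / th))).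
move: k1 k2; rewrite ler_pdivlMr // ltr_pdivrMr // mulrS => k1 k2.
by rewrite ler_norml; apply/andP; split; lra.
Unshelve. all: by end_near. Qed.

(** Finitely many small balls cover the Q-sphere, and each contains at most one
    axis of unit length; each axis is put in some hyperplane. *)
Lemma separated_axes_hyperplane_cover Q D eta :
  (1 < n)%N -> posdef Q -> reflection_closed Q D ->
  0 < eta -> (forall u v, D u -> D v -> bform Q u u = 1 -> bform Q v v = 1 ->
     bform Q (u - v) (u - v) < eta -> u = v) ->
  exists2 ws : seq 'rV[R]_n, (forall w, w \in ws -> w != 0) &
    forall u, D u -> exists2 w, w \in ws & dotp w u = 0.
Proof.
move=> n1 pQ [Dn0 DZ _] eta0 sep; have [sQ pos] := pQ.
have /choice[wf wfP] : forall y, exists w, w != 0 /\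
    forall u, D u -> bform Q u u = 1 -> bform Q (u - y) (u - y) < eta / 4 ->
    dotp w u = 0.
  move=> y.
  have [[u [Du u1 uy]]|no] := pselect (exists u, [/\ D u, bform Q u u = 1 &
      bform Q (u - y) (u - y) < eta / 4]).
    have [w w0 wu] := vector_normal u n1; exists w; split=> // v Dv v1 vy.
    have uv : u = v; last by rewrite -uv.
    apply: (sep u v Du Dv u1 v1).
    have : 0 <= bform Q ((u - y) + (v - y)) ((u - y) + (v - y)).
      have [->|/pos/ltW//] := eqVneq (u - y + (v - y)) 0; by rewrite bform0l.
    have -> : u - v = (u - y) - (v - y) by rewrite opprB addrA subrK.
    move: (u - y) (v - y) uy vy => p q; rewrite !bform_lin (bformC q p sQ); lra.
  have [w w0 _] := @vector_normal R n 0 n1; exists w; split=> // u Du u1 uy.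
  by case: no; exists u.
have := sphere_compact pQ; rewrite compact_cover.
move=> /(_ _ [set x | bform Q x x = 1] (fun y => [set x | bform Q (x - y) (x - y) < eta / 4])).
case.
- move=> y _; apply: (@open_comp _ _ (fun x => bform Q (x - y) (x - y)) [set t | t < eta / 4]);
    last exact: open_lt.
  move=> x _; have cy := @subr_continuous R n y x.
  exact: (bform_continuous (@cst_continuous_at _ _ Q x) cy cy).
- by move=> x x1; exists x => //=; rewrite subrr bform0l divr_gt0.
move=> Y _ cov; exists [seq wf y | y <- finmap.enum_fset Y].
  by move=> _ /mapP[y _ ->]; have [] := wfP y.
move=> u Du; have [e [r [r0 ee ur]]] := posdef_normalize pQ (Dn0 _ Du).
have De : D e.
  have -> : e = r^-1 *: u by rewrite ur scalerA mulVf ?scale1r // gt_eqF.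
  by apply: DZ => //; rewrite invr_eq0 gt_eqF.
have [y /= yY ey] := cov e ee.
exists (wf y); first by apply/mapP; exists y.
by rewrite ur dotpZr (wfP y).2 // mulr0.
Qed.

End SmallAngles.

(** * Subspaces consisting of axes *)

Section AxisSubspaces.
Context (R : realType) (n : nat).
Implicit Types (D : set 'rV[R]_n) (Q V : 'M[R]_n) (x y z u v w e f : 'rV[R]_n).

Definition axis_subspace D V : Prop :=
  forall v, v != 0 -> (v <= V)%MS -> D v.

(** The Q-orthogonal projection of w to V, from the invertible Gram matrix G of a
    basis of V. *)
Lemma posdef_projection Q V w : posdef Q ->
  exists2 p, (p <= V)%MS & forall v, (v <= V)%MS -> bform Q (w - p) v = 0.
Proof.
move=> [sQ pos].
move: (row_base V) (row_base_free V) (eq_row_base V) => B fB eqB.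
pose G := B *m Q *m B^T.
have uG : G \in unitmx.
  rewrite -row_free_unit -kermx_eq0; apply/rowV0P => x /sub_kermxP xG.
  apply: (row_free_inj fB); rewrite mul0mx.
  have xB0 : bform Q (x *m B) (x *m B) = 0.
    rewrite /bform; have := dotp_mull (x *m B *m Q) B^T x; rewrite trmxK => <-.
    by rewrite -(mulmxA x) -mulmxA xG dotp0l.
  by apply/eqP; apply: contra_eqT xB0 => /pos; exact: lt0r_neq0.
pose X := w *m Q *m B^T *m invmx G.
exists (X *m B); first by rewrite -eqB submxMl.
move=> v; rewrite -eqB => /submxP[y ->].
have -> : bform Q (w - X *m B) (y *m B) = dotp ((w - X *m B) *m Q *m B^T) y.
  by rewrite dotp_mull trmxK.
have -> : (w - X *m B) *m Q *m B^T = w *m Q *m B^T - X *m G.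
  by rewrite !mulmxBl /G !mulmxA.
by rewrite /X mulmxKV // subrr dotp0l.
Qed.

(** Write w = q + p with p in V and q orthogonal to V.  Reflecting vectors of V
    in w gives the axes q + y for all y in an affine hyperplane of V (step1).
    Reflections along V rotate y in V, so q + z is an axis for all z of V of
    sufficiently large norm (step2); the rank of V is at least 2 here, for the
    affine hyperplane to contain vectors of every large norm.  Every plane
    spanned by q and a vector of V thus has an arc of axes. *)
Lemma axis_subspace_extend Q D V w : posdef Q -> reflection_closed Q D ->
  (1 < \rank V)%N -> axis_subspace D V -> D w -> ~~ (w <= V)%MS ->
  (exists2 v, (v <= V)%MS & bform Q w v != 0) ->
  axis_subspace D (V + <<w>>)%MS.
Proof.
move=> pQ rD rV DV Dw wV [v0 v0V wv0]; have [sQ pos] := pQ.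
have [Dn0 DZ DR] := rD.
have [p pV pP] := posdef_projection V w pQ; pose q := w - p.
have wE : w = q + p by rewrite /q subrK.
have qP v : (v <= V)%MS -> bform Q q v = 0 by exact: pP.
have q0 : q != 0 by rewrite subr_eq0; apply: contra wV => /eqP ->.
have p0 : p != 0.
  by apply: contra wv0 => /eqP p0; rewrite wE p0 addr0 qP.
move: q wE qP q0 {pP} => q wE qP q0.
have pp := pos _ p0; have qq := pos _ q0.
have qp : bform Q q p = 0 by exact: qP.
have pq : bform Q p q = 0 by rewrite bformC.
have ww : bform Q w w = bform Q q q + bform Q p p.
  by rewrite wE !bform_lin qp pq; ring.
have [e [eV e0 ep]] : exists e, [/\ (e <= V)%MS, e != 0 & bform Q e p = 0].
  have [b bV bp] : exists2 b : 'rV[R]_n, (b <= V)%MS & ~~ (b <= p)%MS.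
    have : ~~ (V <= p)%MS.
      by apply/negP => /mxrankS; rewrite rank_rV p0 leqNgt rV.
    case/row_subPn => i ip; exists (row i V) => //; exact: row_sub.
  exists (b - (bform Q b p / bform Q p p) *: p); split.
  - by rewrite addmx_sub // eqmx_opp scalemx_sub.
  - rewrite subr_eq0; apply: contra bp => /eqP ->; exact: scalemx_sub.
  - by rewrite bformDl bformNl bformZl divfK ?subrr // gt_eqF.
have ee := pos _ e0.
(* s is the value for which p - y is reflected in w to - (q + y) *)
pose s := bform Q p p - bform Q w w / 2.
have step1 y : (y <= V)%MS -> bform Q y p = s -> D (q + y).
  move=> yV yp; pose v := p - y.
  have vV : (v <= V)%MS by rewrite addmx_sub // eqmx_opp.
  have vn0 : v != 0.
    rewrite subr_eq0; apply: contraTneq (pos _ p0) => py.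
    have : bform Q p p = s by rewrite {1}py.
    by rewrite /s ww => h; rewrite -leNgt; lra.
  have := DR _ _ Dw (DV _ vn0 vV).
  have -> : refl Q w v = - (q + y).
    rewrite /refl (_ : _ / _ = 1).
      by rewrite scale1r /v wE; apply/rowP => i; rewrite !mxE; ring.
    have vw : bform Q v w = bform Q w w / 2.
      have -> : bform Q v w = bform Q q v + bform Q v p.
        by rewrite wE bformDr (bformC v q sQ).
      by rewrite qP // add0r /v bformDl bformNl yp /s; lra.
    by rewrite vw; field; rewrite ww gt_eqF // addr_gt0.
  by move/(DZ (-1)); rewrite scaleN1r opprK oppr_eq0 oner_eq0; exact.
(* r0 is the squared norm of the point of the affine hyperplane nearest to 0 *)
pose r0 := s ^+ 2 / bform Q p p.
have step2 z : (z <= V)%MS -> r0 <= bform Q z z -> D (q + z).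
  move=> zV zr; pose be := Num.sqrt ((bform Q z z - r0) / bform Q e e).
  have bb : be * be * bform Q e e = bform Q z z - r0.
    rewrite -expr2 sqr_sqrtr ?divfK ?gt_eqF // divr_ge0 ?subr_ge0 //.
    exact: ltW.
  pose y := (s / bform Q p p) *: p + be *: e.
  have yV : (y <= V)%MS by rewrite addmx_sub // scalemx_sub.
  have yp : bform Q y p = s.
    by rewrite /y bformDl !bformZl ep mulr0 addr0 divfK // gt_eqF.
  have yy : bform Q y y = bform Q z z.
    rewrite /y bformDl !bformDr !bformZl !bformZr ep (bformC p e sQ) ep.
    rewrite !mulr0 addr0 add0r [be * _]mulrA bb /r0; field.
    by rewrite gt_eqF.
  have [<-|yz] := eqVneq y z; first exact: step1.
  have yz0 : y - z != 0 by rewrite subr_eq0.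
  have yzV : (y - z <= V)%MS by rewrite addmx_sub // eqmx_opp.
  have := DR _ _ (DV _ yz0 yzV) (step1 _ yV yp).
  rewrite reflD refl_sub //.
  by rewrite /refl qP // mulr0 mul0r scale0r subr0.
move=> x x0 /sub_addsmxP[[x1 x2] /= xE].
have [v [t [vV {x1 x2 xE}xE]]] : exists v t, (v <= V)%MS /\ x = v + t *: q.
  have : (x2 *m <<w>> <= w)%MS by rewrite (submx_trans (submxMl _ _)) // genmxE.
  move=> /sub_rVP[t tE]; exists (x1 *m V + t *: p), t; split.
    by rewrite addmx_sub ?submxMl // scalemx_sub.
  by rewrite xE tE wE scalerDr addrA addrAC.
have [e1 [a [e11 e1V va]]] : exists e1 a,
    [/\ bform Q e1 e1 = 1, (e1 <= V)%MS & v = a *: e1].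
  have [v00|vn0] := eqVneq v 0.
    have [e1 [r [r_gt0 e11 eE]]] := posdef_normalize pQ e0; exists e1, 0.
    rewrite v00 scale0r; split=> //.
    have -> : e1 = r^-1 *: e by rewrite eE scalerA mulVf ?scale1r // gt_eqF.
    exact: scalemx_sub.
  have [e1 [r [r_gt0 e11 eE]]] := posdef_normalize pQ vn0; exists e1, r; split=> //.
  have -> : e1 = r^-1 *: v by rewrite eE scalerA mulVf ?scale1r // gt_eqF.
  exact: scalemx_sub.
have [f [rho [rho0 ff qE]]] := posdef_normalize pQ q0.
have ef : bform Q e1 f = 0.
  have := qP _ e1V; rewrite qE bformZl (bformC f e1 sQ) => /eqP.
  by rewrite mulf_eq0 gt_eqF //= => /eqP.
have oef : orthonormal2 Q e1 f by [].
have cpos : {for 0, continuous (fun th : R => rho ^+ 2 * cos th ^+ 2 - r0 * sin th ^+ 2)}.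
  have cc : {for 0, continuous (@cos R)} by exact: continuous_cos.
  have cs : {for 0, continuous (@sin R)} by exact: continuous_sin.
  exact: (continuousB
    (continuousM (@cst_continuous_at _ _ (rho ^+ 2) 0) (continuousM cc cc))
    (continuousM (@cst_continuous_at _ _ r0 0) (continuousM cs cs))).
have : \forall th \near (0 : R), 0 < rho ^+ 2 * cos th ^+ 2 - r0 * sin th ^+ 2.
  apply: (cvgr_gt _ cpos).
  by rewrite cos0 sin0 expr1n expr0n /= mulr0 subr0 mulr1 exprn_gt0.
move=> /nbhs_ballP[eps /= eps0 epsP].
move: x0; rewrite xE va qE scalerA.
have mpos : 0 < Num.min eps pi by rewrite lt_min eps0 pi_gt0.
apply: (short_arc_full_plane pQ oef rD mpos) => th th0.
rewrite lt_min => /andP[th1 th2].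
have [->|thn0] := eqVneq th 0.
  rewrite /circle_pt cos0 sin0 scale1r scale0r addr0; apply: DV => //.
  by apply/eqP => e10; move: e11; rewrite e10 bform0l => /eqP; rewrite eq_sym oner_eq0.
have sth : 0 < sin th by apply: sin_gt0_pi; rewrite lt_def thn0 th0.
have := epsP th; rewrite /ball /= sub0r normrN ger0_norm // => /(_ th1) hth.
have -> : circle_pt e1 f th = (sin th / rho) *: (q + (rho * cos th / sin th) *: e1).
  rewrite /circle_pt qE scalerDr !scalerA addrC; congr (_ *: _ + _ *: _); field;
    by rewrite ?gt_eqF.
apply: DZ; first by rewrite mulf_neq0 ?invr_eq0 // gt_eqF.
apply: step2; first exact: scalemx_sub.
rewrite !bform_lin e11 mulr1 -expr2 expr_div_n exprMn ler_pdivlMr ?exprn_gt0 //.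
by rewrite -subr_ge0 ltW.
Qed.

(** When D contains a plane, choose V of maximal rank among the subspaces
    contained in D.  An axis outside V is Q-orthogonal to V, by
    [axis_subspace_extend] and maximality. *)
Lemma axes_dichotomy Q D : (1 < n)%N -> posdef Q -> reflection_closed Q D ->
  coclosed D ->
  (forall u, u != 0 -> D u) \/
  exists2 ws : seq 'rV[R]_n, (forall w, w \in ws -> w != 0) &
    forall u, D u -> exists2 w, w \in ws & dotp w u = 0.
Proof.
move=> n1 pQ rD cD; have [sQ pos] := pQ; have [Dn0 DZ DR] := rD.
have [[e [f [oef fp]]]|noplane] :=
    pselect (exists e f, orthonormal2 Q e f /\ full_plane D e f); last first.
  right; have [[eta [eta0 sep]]|nosep] := pselect (exists eta : R, 0 < eta /\
     forall u v, D u -> D v -> bform Q u u = 1 -> bform Q v v = 1 ->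
     bform Q (u - v) (u - v) < eta -> u = v).
    exact: separated_axes_hyperplane_cover n1 pQ rD eta0 sep.
  case: noplane; apply: (small_angles_plane pQ rD cD) => eta eta0.
  apply: contrapT => no; apply: nosep; exists (Num.min eta 1); split.
    by rewrite lt_min eta0 ltr01.
  move=> u v Du Dv uu vv; rewrite lt_min => /andP[h1 h2].
  apply: contrapT => /eqP uv; apply: no; exists u, v; split=> //; split=> //.
  apply/eqP => uNv; move: h2; rewrite uNv !bform_lin vv; lra.
pose P k := `[< exists V, [/\ \rank V = k, (1 < k)%N & axis_subspace D V] >].
have exP : exists k, P k.
  exists 2; apply/asboolP; exists (e + f)%MS; have [ee ff ef] := oef; split=> //.
    rewrite addsmxE; apply/eqP; rewrite -[_ == _]/(row_free _) -kermx_eq0.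
    apply/rowV0P => x /sub_kermxP.
    rewrite -[x](@hsubmxK _ 1 1 1) mul_row_col.
    set a := lsubmx _; set b := rsubmx _.
    rewrite [a]mx11_scalar [b]mx11_scalar !mul_scalar_mx => h.
    have a0 : a 0 0 = 0.
      have : bform Q (a 0 0 *: e + b 0 0 *: f) e = 0 by rewrite h bform0l.
      by rewrite !bform_lin ee (bformC f e sQ) ef mulr0 addr0 mulr1.
    have b0 : b 0 0 = 0.
      have : bform Q (a 0 0 *: e + b 0 0 *: f) f = 0 by rewrite h bform0l.
      by rewrite !bform_lin ff ef mulr0 add0r mulr1.
    by rewrite a0 b0 !raddf0 row_mx0.
  move=> v v0 /sub_addsmxP[[x1 x2] /= vE]; move: v0; rewrite vE.
  by rewrite [x1]mx11_scalar [x2]mx11_scalar !mul_scalar_mx; exact: fp.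
have ubP k : P k -> (k <= n)%N.
  by move=> /asboolP[V [<- _ _]]; exact: rank_leq_row.
case: (ex_maxnP exP ubP) => k /asboolP[V [rV k1 DV]] kmax {exP ubP}.
have [kn|kn] := eqVneq k n.
  left=> u u0; apply: DV => //; apply: submx_full.
  by rewrite /row_full rV kn.
right.
have [w1 w10 w1V] : exists2 w1 : 'rV[R]_n, w1 != 0 & forall v, (v <= V)%MS -> dotp w1 v = 0.
  have [|w w0 Vw] := @row_space_normal R n n V.
    by rewrite ltn_neqAle rV kn -rV rank_leq_row.
  by exists w => // v /submxP[y ->]; rewrite dotpC dotpE -mulmxA Vw mulmx0 mxE.
have [v0 v0V v00] : exists2 v0 : 'rV[R]_n, (v0 <= V)%MS & v0 != 0.
  by apply/rowV0Pn; rewrite -mxrank_eq0 rV; case: (k) k1.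
have Qv0 : v0 *m Q != 0.
  by apply/eqP => h; have := pos _ v00; rewrite /bform h dotp0l ltxx.
exists [:: w1; v0 *m Q].
  by move=> w; rewrite !inE => /orP[]/eqP ->.
move=> u Du; have [uV|uV] := boolP (u <= V)%MS.
  by exists w1; rewrite ?inE ?eqxx //; exact: w1V.
exists (v0 *m Q); first by rewrite !inE eqxx orbT.
rewrite -/(bform Q v0 u) bformC //; apply/eqP; apply: contraT => uv0.
have ext : axis_subspace D (V + <<u>>)%MS.
  by apply: (axis_subspace_extend pQ rD) => //; [rewrite rV|exists v0].
have lt : (\rank V < \rank (V + <<u>>)%MS)%N.
  have /andP[_ //] : (V <= V + <<u>>)%MS && (\rank V < \rank (V + <<u>>)%MS)%N.
  rewrite -ltmxErank /ltmx addsmxSl /=.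
  apply: contra uV; apply: submx_trans; apply: submx_trans (addsmxSr _ _).
  by rewrite genmxE.
have : P (\rank (V + <<u>>)%MS).
  by apply/asboolP; exists (V + <<u>>)%MS; split=> //; rewrite (leq_trans k1) // -rV ltnW.
by move/kmax; rewrite -rV leqNgt lt.
Qed.

End AxisSubspaces.

(** * Ground hyperplanes of axes in a hyperplane *)

Section SparseNormals.
Context (R : realType) (n : nat).
Implicit Types (O : set 'rV[R]_n) (Q : 'M[R]_n) (g h m u w x y z : 'rV[R]_n).

Lemma open_avoids_hyperplanes O (ms : seq 'rV[R]_n) : open O -> O !=set0 ->
  (forall m, m \in ms -> m != 0) ->
  exists2 g, O g & forall m, m \in ms -> dotp g m != 0.
Proof.
elim: ms O => [|m ms IH] O oO [g0 Og0] ms0; first by exists g0.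
have m0 : m != 0 by apply: ms0; rewrite mem_head.
have [|||g [Og gm] gms] := IH (O `&` [set g | dotp g m != 0]).
- apply: openI => //.
  apply: (@open_comp _ _ (fun g => dotp g m) [set t | t != 0]); last exact: open_neq.
  by move=> g _; apply: dotp_continuous; [exact: cvg_id|exact: cst_continuous_at].
- have [g0m|g0m] := eqVneq (dotp g0 m) 0; last by exists g0.
  have [e e0 eO] := open_along_line m oO Og0.
  exists (g0 + (e / 2) *: m); split.
    by apply: eO; rewrite gtr0_norm ?divr_gt0 //; lra.
  rewrite /= dotpDl dotpZl g0m add0r mulf_neq0 ?dotp_eq0 // gt_eqF //.
  by rewrite divr_gt0.
- by move=> m' m'ms; apply: ms0; rewrite inE m'ms orbT.
- exists g => // m'; rewrite inE => /orP[/eqP ->//|]; exact: gms.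
Qed.

Lemma small_avoid (E : seq R) (eps : R) : 0 < eps ->
  exists s, [/\ 0 < s, s < eps & s \notin E].
Proof.
move=> e0; suff [d [d0 de dE]] : exists d, [/\ 0 < d, d <= eps &
    forall s, s \in E -> 0 < s -> d <= s].
  exists (d / 2); split; [by rewrite divr_gt0|lra|].
  by apply/negP => /dE; rewrite divr_gt0 // => /(_ isT); lra.
elim: E => [|a E [d [d0 de dE]]]; first by exists eps.
have [a0|a0] := ltP 0 a; last first.
  exists d; split=> // s; rewrite inE => /orP[/eqP ->|/dE//].
  by rewrite ltNge a0.
exists (Num.min a d); split.
- by rewrite lt_min a0.
- by rewrite ge_min de orbT.
- move=> s; rewrite inE ge_min => /orP[/eqP ->|/dE h /h ->]; rewrite ?lexx ?orbT //.
Qed.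

Lemma poly_roots_seq (p : {poly R}) : p != 0 ->
  exists rs : seq R, forall x : R, root p x -> x \in rs.
Proof.
have [k] := ubnP (size p); elim: k p => // k IH p sp p0.
have [[a pa]|no] := pselect (exists a, root p a); last first.
  by exists [::] => x px; case: no; exists x.
have /factor_theorem[q pE] := pa.
have q0 : q != 0 by apply: contra p0 => /eqP q0; rewrite pE q0 mul0r.
have [|rs rsP] := IH q _ q0.
  by move: sp; rewrite pE size_Mmonic ?monicXsubC // size_XsubC addn2 /= ltnS.
exists (a :: rs) => x; rewrite pE rootM root_XsubC inE => /orP[/rsP ->|->//].
by rewrite orbT.
Qed.

(** [adj_form Q b] as a polynomial in b; the adjugate, unlike the inverse, exists
    at the eigenvalues of Q too. *)
Definition adj_poly Q x y : {poly R} :=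
  (map_mx polyC x *m \adj (char_poly_mx Q) *m (map_mx polyC y)^T) 0 0.

Definition adj_form Q (b : R) x y : R := dotp (x *m \adj (b%:M - Q)) y.

Lemma adj_polyE Q x y b : (adj_poly Q x y).[b] = adj_form Q b x y.
Proof.
have hE : map_mx (horner_eval b) (char_poly_mx Q) = b%:M - Q.
  rewrite /char_poly_mx map_mxB map_scalar_mx /= /horner_eval hornerX.
  congr (_ - _); apply/matrixP => i j; rewrite !mxE.
  by rewrite /horner_eval hornerC.
have cE (A : 'M[R]_(1, n)) : map_mx (horner_eval b) (map_mx polyC A) = A.
  by apply/matrixP => i j; rewrite !mxE /horner_eval hornerC.
have -> : (adj_poly Q x y).[b] = map_mx (horner_eval b)
    (map_mx polyC x *m \adj (char_poly_mx Q) *m (map_mx polyC y)^T) 0 0.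
  by rewrite [RHS]mxE.
by rewrite !map_mxM map_mx_adj -map_trmx hE !cE -dotpE.
Qed.

Lemma adj_formC Q b x y : Q^T = Q -> adj_form Q b x y = adj_form Q b y x.
Proof.
move=> sQ; rewrite /adj_form dotp_mull trmx_adj linearB /= tr_scalar_mx sQ.
exact: dotpC.
Qed.

(** Any b above the operator norm of Q will do. *)
Lemma resolvent_posdef Q : exists b : R, forall x, x != 0 ->
  0 < dotp (x *m (b%:M - Q)) x.
Proof.
exists (n%:R * (n%:R * `|Q|) + 1) => x x0.
rewrite mulmxBr mul_mx_scalar dotpBl dotpZl subr_gt0.
apply: (@le_lt_trans _ _ (n%:R * (n%:R * `|Q|) * dotp x x)); last first.
  by rewrite mulrDl mul1r ltrDl dotp_gt0.
apply: le_trans (ler_norm _) _; apply: le_trans (dotp_le_norm _ _) _.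
rewrite -mulrA ler_wpM2l //.
apply: (@le_trans _ _ (n%:R * `|Q| * `|x| ^+ 2)).
  apply: (@le_trans _ _ ((n%:R * (`|x| * `|Q|)) * `|x|)).
    by rewrite ler_wpM2r // norm_mulmx_le.
  by rewrite le_eqVlt; apply/orP; left; apply/eqP; ring.
by rewrite ler_wpM2l ?mulr_ge0 // norm_sqr_le_dotp.
Qed.

(** The adjugate of b - Q is the inverse multiplied by the nonzero determinant,
    and the inverse of a positive definite matrix is definite. *)
Lemma resolvent_adj Q b : (forall x, x != 0 -> 0 < dotp (x *m (b%:M - Q)) x) ->
  (forall x, x != 0 -> x *m \adj (b%:M - Q) != 0) /\
  forall x, x != 0 -> adj_form Q b x x != 0.
Proof.
set N := b%:M - Q => pos.
have uN : N \in unitmx.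
  rewrite -row_free_unit -kermx_eq0; apply/rowV0P => x /sub_kermxP xN.
  by apply/eqP; apply: contraT => /pos; rewrite xN dotp0l ltxx.
have dN : \det N != 0 by rewrite -unitfE -unitmxE.
have adjE x : x *m \adj N = \det N *: (x *m invmx N).
  by rewrite -{1}(mulmxKV uN x) -(mulmxA (x *m invmx N)) mul_mx_adj mul_mx_scalar.
have inv0 x : x != 0 -> x *m invmx N != 0.
  by apply: contra => /eqP h; rewrite -(mulmxKV uN x) h mul0mx.
split=> x x0; first by rewrite adjE scaler_eq0 negb_or dN inv0.
rewrite /adj_form adjE dotpZl mulf_neq0 //.
have := pos _ (inv0 _ x0); rewrite mulmxKV // dotpC; exact: lt0r_neq0.
Qed.

(** The image of the hyperplane orthogonal to w under u |-> u (Q - b) is a proper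
    subspace, even when Q - b is singular. *)
Lemma shifted_hyperplane_normal Q w b : Q^T = Q -> w != 0 ->
  exists2 m, m != 0 & forall u, dotp w u = 0 -> dotp (u *m (Q - b%:M)) m = 0.
Proof.
move=> sQ w0; have sN : (Q - b%:M)^T = Q - b%:M.
  by rewrite linearB /= tr_scalar_mx sQ.
have [uN|] := boolP (Q - b%:M \in unitmx).
  exists (w *m invmx (Q - b%:M)).
    by apply: contra w0 => /eqP h; rewrite -(mulmxKV uN w) h mul0mx.
  by move=> u wu; rewrite dotp_mull sN mulmxKV // dotpC.
rewrite -row_free_unit -kermx_eq0 => /rowV0Pn[m /sub_kermxP mN m0].
by exists m => // u _; rewrite dotp_mull sN mN dotp0r.
Qed.

(** Write <x, y>_b for [adj_form Q b x y].  If u Q = b u + a g with a nonzero and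
    u orthogonal to both g and w, then multiplying u (b - Q) = - a g by the
    adjugate of b - Q gives <g, w>_b = 0 and <g, g>_b = 0.  Consider these
    equations on a line g + s h.  The first one reads R0(b) + s R1(b) = 0, where
    R0(b) = <g, w>_b and R1(b) = <h, w>_b; eliminating s from the second one
    leaves T(b) = <z, z>_b = 0 with z = R1(b) g - R0(b) h.  At a value b1 where
    b1 - Q is positive definite and R1 does not vanish, T(b1) is nonzero, so T
    has finitely many roots b.  If R1(b) is nonzero, then b determines s.  If
    R1(b) = 0, then b is one of finitely many values that do not depend on g,
    and g + s h lies in the image under Q - b of the hyperplane orthogonal to w;
    as g is chosen outside these images, this determines s again.  So all but
    finitely many s give a point of the line that has no such u. *)
Lemma sparse_normals Q O (ws : seq 'rV[R]_n) : (1 < n)%N -> Q^T = Q ->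
  open O -> O !=set0 -> (forall w, w \in ws -> w != 0) ->
  exists2 g, O g & forall w u (be al : R), w \in ws -> al != 0 ->
    dotp g u = 0 -> u *m Q = be *: u + al *: g -> dotp w u != 0.
Proof.
move=> n1 sQ oO O0 ws0.
have [b1 /resolvent_adj[adj0 adjpos]] := resolvent_posdef Q.
have [|||h _ hw] := @open_avoids_hyperplanes setT [seq w *m \adj (b1%:M - Q) | w <- ws].
- exact: openT.
- by exists 0.
- by move=> _ /mapP[w /ws0 w0 ->]; exact: adj0.
pose R1 w := adj_poly Q h w.
have R1n w : w \in ws -> R1 w != 0.
  move=> wws; apply/eqP => h0; have := adj_polyE Q h w b1.
  rewrite -/(R1 w) h0 horner0 adj_formC // /adj_form dotpC => /esym/eqP.
  by apply/negP/hw/map_f.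
(* rts p lists the roots of a nonzero p, and mm (w, b) is a normal of the image
   of the hyperplane orthogonal to w under Q - b. *)
have /choice[rts rtsP] : forall p : {poly R}, exists rs : seq R, p != 0 ->
    forall x : R, root p x -> x \in rs.
  move=> p; have [->|/poly_roots_seq[rs rsP]] := eqVneq p 0; first by exists [::].
  by exists rs.
have /choice[mm mmP] : forall wb : 'rV[R]_n * R, exists m, wb.1 != 0 -> m != 0 /\
    forall u, dotp wb.1 u = 0 -> dotp (u *m (Q - wb.2%:M)) m = 0.
  move=> [w b] /=; have [->|/(shifted_hyperplane_normal b sQ)[m m0 mP]] := eqVneq w 0.
    by exists 0.
  by exists m.
(* avoiding the hyperplane orthogonal to k keeps g off the line of h *)
have [k k0 kh] := vector_normal h n1.
have [|g Og gms] := @open_avoids_hyperplanes O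
    (k :: [seq mm (w, b) | w <- ws, b <- rts (R1 w)]) oO O0.
  move=> m; rewrite inE => /orP[/eqP -> //|/allpairsPdep[w [b [wws _ ->]]]].
  by have [] := mmP (w, b) (ws0 _ wws).
have gk : dotp g k != 0 by apply: gms; rewrite mem_head.
pose R0 w := adj_poly Q g w.
pose T w := R1 w * (R1 w * adj_poly Q g g - R0 w * adj_poly Q g h) -
  R0 w * (R1 w * adj_poly Q g h - R0 w * adj_poly Q h h).
have TE w b : (T w).[b] = adj_form Q b ((R1 w).[b] *: g - (R0 w).[b] *: h)
    ((R1 w).[b] *: g - (R0 w).[b] *: h).
  rewrite /T !(hornerD, hornerN, hornerM) !adj_polyE.
  have ahg := adj_formC b h g sQ; move: ahg; rewrite /adj_form => ahg.
  by rewrite !mulmxBl -!scalemxAl !dotp_lin ahg; ring.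
have Tn w : w \in ws -> T w != 0.
  move=> wws; apply/eqP => T0; have := TE w b1; rewrite T0 horner0 => /esym/eqP.
  apply/negP/adjpos; apply/eqP => z0.
  have R10 : (R1 w).[b1] != 0.
    by rewrite adj_polyE adj_formC // /adj_form dotpC; apply/hw/map_f.
  have := congr1 (fun v => dotp v k) z0.
  rewrite dotp0l dotpBl !dotpZl (dotpC h) kh mulr0 subr0 => /eqP.
  by rewrite mulf_eq0 (negbTE R10) (negbTE gk).
pose E1 := [seq - (R0 w).[b] / (R1 w).[b] | w <- ws, b <- rts (T w)].
pose E2 := [seq - dotp g (mm (w, b)) / dotp h (mm (w, b)) | w <- ws, b <- rts (R1 w)].
have [eps eps0 epsO] := open_along_line h oO Og.
have [s [s0 seps sE]] := small_avoid (E1 ++ E2) eps0.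
exists (g + s *: h); first by apply: epsO; rewrite gtr0_norm.
move=> w u b al wws al0 gu uQ; apply/eqP => wu.
have uN : u *m (b%:M - Q) = (- al) *: (g + s *: h).
  by rewrite mulmxBr mul_mx_scalar uQ opprD addrA subrr add0r scaleNr.
have adjE : al *: ((g + s *: h) *m \adj (b%:M - Q)) = - \det (b%:M - Q) *: u.
  rewrite scaleNr -[\det _ *: u]mul_mx_scalar -mul_mx_adj mulmxA uN scaleNr mulNmx opprK.
  by rewrite scalemxAl.
have gadj y : dotp u y = 0 -> adj_form Q b (g + s *: h) y = 0.
  move=> uy; apply/eqP; rewrite -(mulrI_eq0 _ (mulfI al0)) /adj_form -dotpZl.
  by rewrite adjE dotpZl uy mulr0.
have gw : adj_form Q b (g + s *: h) w = 0 by apply: gadj; rewrite dotpC.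
have gg : adj_form Q b (g + s *: h) (g + s *: h) = 0 by apply: gadj; rewrite dotpC.
have R01 : (R0 w).[b] + s * (R1 w).[b] = 0.
  by move: gw; rewrite !adj_polyE /adj_form mulmxDl -scalemxAl dotpDl dotpZl.
move: sE; rewrite mem_cat negb_or => /andP[sE1 sE2].
have bT : root (T w) b.
  rewrite rootE TE (_ : _ - _ = (R1 w).[b] *: (g + s *: h)).
    by rewrite /adj_form -scalemxAl dotpZl dotpZr -/(adj_form _ _ _ _) gg !mulr0.
  rewrite (_ : (R0 w).[b] = - (s * (R1 w).[b])); last first.
    by apply/eqP; rewrite -addr_eq0 R01.
  by rewrite scaleNr opprK scalerDr scalerA mulrC.
have [R1b|R1b] := eqVneq (R1 w).[b] 0; last first.
  move/negP: sE1; apply; apply/allpairsPdep; exists w, b; split=> //.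
    exact: rtsP (Tn _ wws) _ bT.
  have -> : - (R0 w).[b] = s * (R1 w).[b].
    by apply/eqP; rewrite eq_sym -addr_eq0 addrC R01.
  by rewrite mulfK.
have bR : b \in rts (R1 w) by apply: rtsP (R1n _ wws) _ _; rewrite rootE R1b.
have [m0 mP] := mmP (w, b) (ws0 _ wws).
have gm : dotp g (mm (w, b)) != 0.
  by apply: gms; rewrite inE; apply/orP; right; apply/allpairsPdep; exists w, b.
have : dotp (g + s *: h) (mm (w, b)) = 0.
  have := mP _ wu; rewrite /= -opprB mulmxN uN scaleNr opprK dotpZl => /eqP.
  by rewrite mulf_eq0 (negbTE al0) => /eqP.
rewrite dotpDl dotpZl => gsh.
move/negP: sE2; apply; apply/allpairsPdep; exists w, b; split=> //.
have -> : - dotp g (mm (w, b)) = s * dotp h (mm (w, b)) by lra.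
rewrite mulfK //; apply: contra gm => /eqP hm.
by move: gsh; rewrite hm mulr0 addr0 => ->.
Qed.

End SparseNormals.

(** * The three characterisations *)

Section Conclusion.
Context (R : realType) (n : nat) (K : set 'rV[R]_n) (bK : convex_body K).

Lemma invariant_pair_exists : exists Q c, invariant_pair K Q c.
Proof.
have [c Kc cP] := invariant_center bK; have [Q pQ QP] := invariant_form bK.
by exists Q, c; split=> // M b sM; split; [exact: cP|exact: QP sM].
Qed.

(** If [refl Q y] around c moves some point of K outside K, so does [refl Q z]
    for z near y, because K is closed. *)
Lemma axes_coclosed Q c : posdef Q -> coclosed (axes K Q c).
Proof.
move=> pQ y y0 ny.
have [x [Kx nKx]] : exists x, K (c + x) /\ ~ K (c + refl Q y x).
  apply: contrapT => no; apply: ny; split=> // x Kx.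
  by apply: contrapT => nK; apply: no; exists x.
have clK : closed K by apply: compact_closed; [exact: norm_hausdorff|case: bK].
have cid : {for y, continuous (@id 'rV[R]_n)} by exact: cvg_id.
have ccst (T : topologicalType) (a : T) := @cst_continuous_at _ T a y.
have c1 : {for y, continuous (fun z => bform Q x z)}.
  exact: (bform_continuous (ccst _ Q) (ccst _ x) cid).
have c2 : {for y, continuous (fun z => bform Q z z)}.
  exact: (bform_continuous (ccst _ Q) cid cid).
have c3 : {for y, continuous (fun z => (bform Q z z)^-1)}.
  by apply: (continuousV _ c2); exact: posdef_neq0.
have cr : {for y, continuous (fun z => c + refl Q z x)}.
  apply: mx_continuous => i j.
  have -> : (fun z => (c + refl Q z x) i j) =
      (fun z => (c + x) i j - 2 * bform Q x z * (bform Q z z)^-1 * z i j).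
    by apply/funext => z; rewrite /refl !mxE addrA.
  have cz : {for y, continuous (fun z : 'rV[R]_n => z i j)}.
    exact: coord_comp_continuous.
  exact: (continuousB (ccst _ _)
    (continuousM (continuousM (continuousM (ccst _ _) c1) c3) cz)).
have : \forall z \near y, (~` K) (c + refl Q z x).
  by apply: (cr (~` K)); apply: open_nbhs_nbhs; split=> //; rewrite openC.
by apply: filterS => z nz [_ /(_ _ Kx)].
Qed.

Lemma open_axes_ellipsoid Q c O : invariant_pair K Q c -> open O -> O !=set0 ->
  O `<=` axes K Q c -> ellipsoid K.
Proof.
move=> [pQ Kc _] oO [u Ou] OD; have rD := axes_reflection_closed K c pQ.
apply: (axes_full_ellipsoid bK pQ Kc); first by exists u; have [] := OD _ Ou.
exact: open_axes_full pQ rD oO Ou OD.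
Qed.

Lemma thick_flat_midpoint_ellipsoid : thick (flat_midpoint_lines K) -> ellipsoid K.
Proof.
move=> /thick_lines [W [oW W0] WP]; have [Q [c iK]] := invariant_pair_exists.
apply: (open_axes_ellipsoid iK oW W0) => u /WP [u0 [l [fl ul]]].
have [a [p [au sK]]] := flat_midpoint_skew bK fl ul u0.
by have [] := skew_reflection_axes iK au sK.
Qed.

Lemma thick_reflection_ellipsoid : thick (reflection_lines K) -> ellipsoid K.
Proof.
move=> /thick_lines [W [oW W0] WP]; have [Q [c iK]] := invariant_pair_exists.
apply: (open_axes_ellipsoid iK oW W0) => u /WP [u0 [l [[r [p [H [rr rK]]]] ul]]].
by have [] := reflection_axes iK rr rK ul u0.
Qed.

Lemma thick_ground_ellipsoid :
  thick (nonorthogonal_ground_hyperplanes K) -> ellipsoid K.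
Proof.
move=> tK; have [Q [c iK]] := invariant_pair_exists; have [pQ Kc _] := iK.
have n1 : (1 < n)%N.
  have [U [_ [G UG] /(_ _ UG)]] := tK.
  move=> [r [l [p [H [_ _ _ [/dimvS]]]]]].
  by rewrite (eqP (valP l)) (eqP (valP G)) ltn_predRL.
have [W [oW W0] WP] := thick_hyperplanes (ltnW n1) tK.
have [] := axes_dichotomy n1 pQ (axes_reflection_closed K c pQ) (axes_coclosed pQ).
  have [g /WP [g0 _]] := W0.
  by apply: (axes_full_ellipsoid bK pQ Kc); exists g.
move=> [ws ws0 wsP]; have [g Wg gP] := sparse_normals n1 pQ.1 oW W0 ws0.
have [g0 [G GK Gg]] := WP _ Wg.
have [u [al [be [Du al0 gu uQ]]]] := ground_axes iK GK g0 Gg.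
have [w wws /eqP wu] := wsP _ Du.
by have := gP _ _ _ _ wws al0 gu uQ; rewrite wu.
Qed.

End Conclusion.

Theorem theorem2 (R : realType) (n : nat) (K : set 'rV[R]_n)
    (hK : convex_body K) :
  [\/ thick (flat_midpoint_lines K),
      thick (reflection_lines K)
    | thick (nonorthogonal_ground_hyperplanes K)] ->
  ellipsoid K.
Proof.
case; [exact: thick_flat_midpoint_ellipsoid
  |exact: thick_reflection_ellipsoid|exact: thick_ground_ellipsoid].
Qed.
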